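(* The following is a theorem of INF. Suppose $\mathbb{N}$ is finite and there is a double successor $\mathsf{S}k=\mathsf{S}n$ with $k\neq n$, $n\in\mathbb{N}$ and $k\in\mathrm{STEM}$. Then there is exactly one double successor. More precisely, if $j,\ell\in\mathbb{N}$, $j\neq\ell$, $j<\ell$ and $\mathsf{S}j=\mathsf{S}\ell$, then $j=k$ and $\ell=n$.
   Context: INF (intuitionistic New Foundations) is the first-order theory with equality over intuitionistic logic, with one binary predicate $\in$, whose axioms are extensionality ($\forall z(z\in x\leftrightarrow z\in y)\to x=y$) and stratified comprehension (the set $\{x:\varphi\}$ exists for every stratified $\varphi$, parameters allowed; $\varphi$ is stratified if its variables can be assigned natural-number indices so that in each subformula $x\in y$ the index of $y$ is one more than that of $x$, and in each $x=y$ the indices agree). Ordered pairs are $\langle x,y\rangle=\{\{x\},\{x,y\}\}$. $\mathrm{FUNC}=\{f:\forall x,y,z(\langle x,y\rangle\in f\to\langle x,z\rangle\in f\to y=z)\}$. Application: $Ap(f,x)=\{t:\exists y(\langle x,y\rangle\in f\land t\in y)\}$, so $Ap(f,x)=y$ if $f\in\mathrm{FUNC}$ and $\langle x,y\rangle\in f$. Write $fx$ or $f(x)$ for $Ap(f,x)$, associating to the left. Church numbers: $\mathbf{0}=\{\langle f,\mathrm{id}\rangle: f=f\}$ with $\mathrm{id}=\{\langle x,x\rangle:x=x\}$. Church successor is the set of all pairs $\langle z,s_z\rangle$ with $z\in\mathrm{FUNC}$, where $s_z$ is the set of all $\langle f,p\rangle$ with $f\in\mathrm{FUNC}$ and $\forall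 u\,(u\in p\leftrightarrow\exists x,w,t,q\,(u=\langle x,w\rangle\land t\in\mathrm{FUNC}\land\langle f,t\rangle\in z\land\langle x,q\rangle\in t\land\langle q,w\rangle\in f))$; it is denoted $\mathsf{S}$. $\mathbb{N}$ is the intersection of all sets containing $\mathbf{0}$ and closed under $\mathsf{S}$. Addition on $\mathbb{N}$: with ordered triples $\langle x,y,z\rangle$, $Sum$ is the intersection of all sets $X$ such that $\langle x,\mathbf{0},x\rangle\in X$ for all $x\in\mathbb{N}$ and, for $x,n,y\in\mathbb{N}$, $\langle x,n,y\rangle\in X\to\langle x,\mathsf{S}n,\mathsf{S}y\rangle\in X$; $x\oplus n$ is the unique $y\in\mathbb N$ with $\langle x,n,y\rangle\in Sum$. Order on $\mathbb{N}$: $x<y\iff\exists n\in\mathbb{N}\,(x\oplus\mathsf{S}n=y)$. A double successor is a $p$ such that $p=\mathsf{S}a=\mathsf{S}b$ for some $a,b\in\mathbb{N}$ with $a\ne b$. $\mathrm{STEM}$ is the intersection of $\mathbb{N}$ and all sets $X$ such that $\mathbf{0}\in X$ and $\forall u\in\mathbb{N}\,(u\in X\land\forall v\in\mathbb{N}(\mathsf{S}v=\mathsf{S}u\to v=u)\to\mathsf{S}u\in X)$. A set is finite if it belongs to $\mathrm{FINITE}$, the intersection of all sets $w$ with $\emptyset\in w$ and $\forall x,c\,(x\in w\land c\notin x\to x\cup\{c\}\in w)$. *)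

(* Defs.v *)
From Stdlib Require Import List.

(** * Intuitionistic first-order logic with equality, one binary predicate *)

(** De Bruijn indices.  The language has no function symbols, so the only terms
    are variables and every substitution is a renaming. *)
Inductive form : Type :=
| Bot : form
| Mem : nat -> nat -> form
| Eq  : nat -> nat -> form
| Imp : form -> form -> form
| And : form -> form -> form
| Or  : form -> form -> form
| All : form -> form
| Ex  : form -> form.

Definition scons {X : Type} (a : X) (s : nat -> X) (n : nat) : X :=
  match n with 0 => a | S m => s m end.

Definition up (r : nat -> nat) : nat -> nat := scons 0 (fun n => S (r n)).

Fixpoint ren (r : nat -> nat) (p : form) : form :=
  match p with
  | Bot => Bot
  | Mem x y => Mem (r x) (r y)
  | Eq x y => Eq (r x) (r y)
  | Imp p q => Imp (ren r p) (ren r q)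
  | And p q => And (ren r p) (ren r q)
  | Or p q => Or (ren r p) (ren r q)
  | All p => All (ren (up r) p)
  | Ex p => Ex (ren (up r) p)
  end.

Definition shift : form -> form := ren S.
Definition inst (p : form) (x : nat) : form := ren (scons x (fun n => n)) p.

Definition Iff (p q : form) : form := And (Imp p q) (Imp q p).

(** Natural deduction from a set [T] of axioms.  [nd_ax] is available in every
    context and [nd_allI] does not restrict it, so a free variable of an axiom
    is implicitly universally quantified. *)
Inductive nd (T : form -> Prop) : list form -> form -> Prop :=
| nd_ax   G p : T p -> nd T G p
| nd_hyp  G p : In p G -> nd T G p
| nd_botE G p : nd T G Bot -> nd T G p
| nd_impI G p q : nd T (p :: G) q -> nd T G (Imp p q)
| nd_impE G p q : nd T G (Imp p q) -> nd T G p -> nd T G q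
| nd_andI G p q : nd T G p -> nd T G q -> nd T G (And p q)
| nd_andE1 G p q : nd T G (And p q) -> nd T G p
| nd_andE2 G p q : nd T G (And p q) -> nd T G q
| nd_orI1 G p q : nd T G p -> nd T G (Or p q)
| nd_orI2 G p q : nd T G q -> nd T G (Or p q)
| nd_orE  G p q r :
    nd T G (Or p q) -> nd T (p :: G) r -> nd T (q :: G) r -> nd T G r
| nd_allI G p : nd T (map shift G) p -> nd T G (All p)
| nd_allE G p x : nd T G (All p) -> nd T G (inst p x)
| nd_exI  G p x : nd T G (inst p x) -> nd T G (Ex p)
| nd_exE  G p q :
    nd T G (Ex p) -> nd T (p :: map shift G) (shift q) -> nd T G q
| nd_eqI  G x : nd T G (Eq x x)
| nd_eqE  G p x y : nd T G (Eq x y) -> nd T G (inst p x) -> nd T G (inst p y).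

(** * The theory INF *)

(** [s] gives the indices (types) of the free variables; each bound variable
    gets an index of its own. *)
Fixpoint stratified_by (s : nat -> nat) (p : form) : Prop :=
  match p with
  | Bot => True
  | Mem x y => s y = S (s x)
  | Eq x y => s x = s y
  | Imp p q | And p q | Or p q => stratified_by s p /\ stratified_by s q
  | All p | Ex p => exists i, stratified_by (scons i s) p
  end.

Definition stratified (p : form) : Prop := exists s, stratified_by s p.

Inductive INF : form -> Prop :=
| INF_ext :
    INF (All (All (Imp (All (Iff (Mem 0 2) (Mem 0 1))) (Eq 1 0))))
(** Variable 0 of [p] is the abstracted one and the others are parameters;
    [up S] makes room for the set being asserted to exist, so that it does not
    occur in [p]. *)
| INF_comp p : stratified p ->
    INF (Ex (All (Iff (Mem 0 1) (ren (up S) p)))).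

(** * Formulas with named binders and class abstracts *)

(** An [fm] is a formula parametrised by the number of enclosing binders.
    Variables are de Bruijn levels (the outermost binder is 0), which keep their
    meaning under further binders; [ix] turns them into indices. *)
Definition fm : Type := nat -> form.

Definition closed (p : fm) : form := p 0.

Definition ix (d l : nat) : nat := d - S l.

(** Class abstracts are not terms of the language: [mem] and [eqt] eliminate
    them in favour of their defining formulas. *)
Inductive tm : Type :=
| Var : nat -> tm
| Cls : (nat -> fm) -> tm.

Definition compr (P : tm -> fm) : tm := Cls (fun l => P (Var l)).

Definition fbot : fm := fun _ => Bot.
Definition fimp (p q : fm) : fm := fun d => Imp (p d) (q d).
Definition fconj (p q : fm) : fm := fun d => And (p d) (q d).
Definition fdisj (p q : fm) : fm := fun d => Or (p d) (q d).
Definition fiff (p q : fm) : fm := fun d => Iff (p d) (q d).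
Definition fall (P : tm -> fm) : fm := fun d => All (P (Var d) (S d)).
Definition fex (P : tm -> fm) : fm := fun d => Ex (P (Var d) (S d)).

Definition has (b : tm) (x : nat) : fm :=
  match b with
  | Var y => fun d => Mem (ix d x) (ix d y)
  | Cls P => P x
  end.

Definition eqt (a b : tm) : fm :=
  match a, b with
  | Var x, Var y => fun d => Eq (ix d x) (ix d y)
  | _, _ => fun d => All (Iff (has a d (S d)) (has b d (S d)))
  end.

Definition mem (a b : tm) : fm :=
  match a with
  | Var x => has b x
  | Cls _ => fun d => Ex (And (eqt (Var d) a (S d)) (has b d (S d)))
  end.

Declare Scope fm_scope.
Delimit Scope fm_scope with fm.
Bind Scope fm_scope with fm.
Bind Scope fm_scope with tm.
Open Scope fm_scope.

Notation "a ∈ b" := (mem a b) (at level 70, no associativity) : fm_scope.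
Notation "a ≐ b" := (eqt a b) (at level 70, no associativity) : fm_scope.
Notation "¬ p" := (fimp p fbot) (at level 75, right associativity) : fm_scope.
Notation "p ∧ q" := (fconj p q) (at level 80, right associativity) : fm_scope.
Notation "p ∨ q" := (fdisj p q) (at level 85, right associativity) : fm_scope.
Notation "p ⇒ q" := (fimp p q) (at level 90, right associativity) : fm_scope.
Notation "p ⇔ q" := (fiff p q) (at level 95, no associativity) : fm_scope.
Notation "∀ x .. y , p" := (fall (fun x => .. (fall (fun y => p)) ..))
  (at level 200, x binder, y binder, right associativity) : fm_scope.
Notation "∃ x .. y , p" := (fex (fun x => .. (fex (fun y => p)) ..))
  (at level 200, x binder, y binder, right associativity) : fm_scope.
Notation "⦃ x | p ⦄" := (compr (fun x => p))
  (at level 0, x name, p at level 200) : fm_scope.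

(** * Set-theoretic vocabulary *)

Definition empty : tm := ⦃ x | fbot ⦄.
Definition sing (x : tm) : tm := ⦃ z | z ≐ x ⦄.
Definition upair (x y : tm) : tm := ⦃ z | z ≐ x ∨ z ≐ y ⦄.
Definition union (a b : tm) : tm := ⦃ z | z ∈ a ∨ z ∈ b ⦄.

Definition opair (x y : tm) : tm := upair (sing x) (upair x y).

(** The double singleton puts the third component at the level of
    [opair x y], so that the triple is stratified with x, y, z of equal index. *)
Definition triple (x y z : tm) : tm := opair (opair x y) (sing (sing z)).

Definition FUNC : tm :=
  ⦃ f | ∀ x y z, opair x y ∈ f ⇒ opair x z ∈ f ⇒ y ≐ z ⦄.

Definition Ap (f x : tm) : tm := ⦃ t | ∃ y, opair x y ∈ f ∧ t ∈ y ⦄.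

Definition FINITE : tm :=
  ⦃ a | ∀ w,
      empty ∈ w ∧ (∀ x c, x ∈ w ∧ ¬ c ∈ x ⇒ union x (sing c) ∈ w) ⇒ a ∈ w ⦄.

(** * Church numbers *)

Definition ident : tm := ⦃ u | ∃ x, x ≐ x ∧ u ≐ opair x x ⦄.

Definition zero : tm := ⦃ u | ∃ f, f ≐ f ∧ u ≐ opair f ident ⦄.

Definition succ_of (z : tm) : tm :=
  ⦃ v | ∃ f p, v ≐ opair f p ∧ f ∈ FUNC ∧
      (∀ u, u ∈ p ⇔
         (∃ x w t q, u ≐ opair x w ∧ t ∈ FUNC ∧ opair f t ∈ z ∧
                     opair x q ∈ t ∧ opair q w ∈ f)) ⦄.

Definition SUCC : tm := ⦃ v | ∃ z, v ≐ opair z (succ_of z) ∧ z ∈ FUNC ⦄.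

Definition succ (n : tm) : tm := Ap SUCC n.

Definition NN : tm :=
  ⦃ n | ∀ X, zero ∈ X ∧ (∀ u, u ∈ X ⇒ succ u ∈ X) ⇒ n ∈ X ⦄.

Definition Sum : tm :=
  ⦃ v | ∀ X,
      (∀ x, x ∈ NN ⇒ triple x zero x ∈ X) ∧
      (∀ x n y, x ∈ NN ∧ n ∈ NN ∧ y ∈ NN ⇒
         triple x n y ∈ X ⇒ triple x (succ n) (succ y) ∈ X) ⇒
      v ∈ X ⦄.

(** x ⊕ n = y, where x ⊕ n is a definite description. *)
Definition plus_is (x n y : tm) : fm :=
  (y ∈ NN ∧ triple x n y ∈ Sum) ∧
  (∀ y', y' ∈ NN ∧ triple x n y' ∈ Sum ⇒ y' ≐ y).

Definition lt (x y : tm) : fm := ∃ n, n ∈ NN ∧ plus_is x (succ n) y.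

Definition double_successor (p : tm) : fm :=
  ∃ a b, a ∈ NN ∧ b ∈ NN ∧ ¬ a ≐ b ∧ p ≐ succ a ∧ p ≐ succ b.

Definition STEM : tm :=
  ⦃ s | s ∈ NN ∧ (∀ X,
      zero ∈ X ∧
      (∀ u, u ∈ NN ⇒
         u ∈ X ∧ (∀ v, v ∈ NN ⇒ succ v ≐ succ u ⇒ v ≐ u) ⇒ succ u ∈ X) ⇒
      s ∈ X) ⦄.

Definition fex_unique (P : tm -> fm) : fm :=
  ∃ p, P p ∧ (∀ q, P q ⇒ q ≐ p).

(* Main.v *)
(** The number [n] is reachable from [k], and [k] does not lie on a cycle because it is in [STEM]; so
    the orbit of zero runs through [k] into the cycle of [S k], which it closes at [n].  For any
    branching [S a = S b] with [a] before [b], the point [b] is on a cycle, hence on that one, and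
    [a] is not, because the successor is injective on a cycle; so [a] lies before the cycle and its
    successor on it, that is [a = k] and then [b = n].  All case distinctions needed come from the
    comparability of points under reachability, which is constructive, and from decidability of
    equality on [N], the only use of finiteness.

    To argue in the object theory, formulas are interpreted as truth values, monotone sets of
    contexts, over which the connectives become those of Rocq; a formula holds in a context exactly
    if it is derivable from it. *)

From Stdlib Require Import List Arith Lia.
Require Import Defs.

(** * Renamings *)

(** Two obstacles shape the argument. Paths cannot be measured by outside integers, so reachability
    is defined, like N itself, as an intersection of sets closed under a relation, and every
    induction requires a stratified formula. Replacing the Church successor by a set [R] of pairs
    keeps these formulas short; what is used about Church numbers then shrinks to a few facts,
    chiefly that zero is no successor. Excluded middle is missing too, so one cannot ask whether a
    given point lies on the cycle. Instead two points are compared under reachability, and either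
    order is followed to an equality or to a contradiction. On the logical side, plain forcing over
    contexts would make a disjunction hold only where one disjunct is already derivable. The remedy
    is to close truth values under elimination into formulas, which is just what the calculus can do
    with a disjunction or an existential statement. *)

Lemma up_ext r r' : (forall i, r i = r' i) -> forall i, up r i = up r' i.
Proof. intros E [|i]; cbn; auto. Qed.

Lemma ren_ext p : forall r r', (forall i, r i = r' i) -> ren r p = ren r' p.
Proof.
  induction p; intros r r' E; cbn; f_equal; auto using up_ext.
Qed.

Lemma ren_ren p : forall r r', ren r' (ren r p) = ren (fun i => r' (r i)) p.
Proof.
  induction p; intros r r'; cbn; f_equal; auto;
    rewrite IHp; apply ren_ext; intros [|i]; reflexivity.
Qed.

Lemma ren_id p : forall r, (forall i, r i = i) -> ren r p = p.
Proof.
  induction p; intros r E; cbn; f_equal; auto;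
    apply IHp; intros [|i]; cbn; auto.
Qed.

Lemma ren_inst r p x : ren r (inst p x) = inst (ren (up r) p) (r x).
Proof.
  unfold inst. rewrite !ren_ren. apply ren_ext. intros [|i]; reflexivity.
Qed.

Lemma inst_up p r x : inst (ren (up r) p) x = ren (scons x r) p.
Proof. unfold inst. rewrite ren_ren. apply ren_ext. intros [|i]; reflexivity. Qed.

Lemma ren_shift r p : ren (up r) (shift p) = shift (ren r p).
Proof. unfold shift. rewrite !ren_ren. apply ren_ext. reflexivity. Qed.

Lemma map_ren_shift r G :
  map (ren (up r)) (map shift G) = map shift (map (ren r) G).
Proof. rewrite !map_map. apply map_ext. intro p. apply ren_shift. Qed.

Fixpoint fv_below (n : nat) (p : form) : Prop :=
  match p with
  | Bot => True
  | Mem x y | Eq x y => x < n /\ y < n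
  | Imp p q | And p q | Or p q => fv_below n p /\ fv_below n q
  | All p | Ex p => fv_below (S n) p
  end.

Lemma fv_below_mono p : forall n m, n <= m -> fv_below n p -> fv_below m p.
Proof.
  induction p; cbn; intros n' m L; try (intuition eauto; lia); apply IHp; lia.
Qed.

Lemma fv_below_exists p : exists n, fv_below n p.
Proof.
  induction p; cbn;
    try (destruct IHp1 as [n1 H1], IHp2 as [n2 H2]; exists (n1 + n2);
         split; [apply (fv_below_mono _ n1) | apply (fv_below_mono _ n2)]; auto; lia).
  - now exists 0.
  - exists (S (n + n0)). lia.
  - exists (S (n + n0)). lia.
  - destruct IHp as [n H]. exists n. apply (fv_below_mono _ n); auto.
  - destruct IHp as [n H]. exists n. apply (fv_below_mono _ n); auto.
Qed.

Lemma ctx_below_exists G : exists n, Forall (fv_below n) G.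
Proof.
  induction G as [|p G [n H]].
  - now exists 0.
  - destruct (fv_below_exists p) as [m Hm]. exists (n + m). constructor.
    + apply (fv_below_mono _ m); auto; lia.
    + eapply Forall_impl; [|exact H]. intros q. apply fv_below_mono. lia.
Qed.

Lemma ren_ext_below p : forall n r r', fv_below n p ->
  (forall i, i < n -> r i = r' i) -> ren r p = ren r' p.
Proof.
  induction p; intros n' r r' B E; cbn in *; f_equal;
    first
      [ reflexivity
      | apply E; lia
      | apply (IHp1 n'); [tauto|exact E]
      | apply (IHp2 n'); [tauto|exact E]
      | apply (IHp (S n')); [exact B|]; intros [|i] L; cbn; [reflexivity|];
        rewrite E; [reflexivity|lia] ].
Qed.

(** * Admissible rules *)

Lemma incl_cons2 (p : form) G G' : incl G G' -> incl (p :: G) (p :: G').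
Proof. intros I q [E|K]; [now left|right; auto]. Qed.

Lemma weakening T G p : nd T G p -> forall G', incl G G' -> nd T G' p.
Proof.
  induction 1; intros G' I;
    try solve [econstructor; eauto using incl_cons2].
  - apply nd_allI, IHnd. now apply incl_map.
  - eapply nd_exE; [now apply IHnd1|]. apply IHnd2, incl_cons2. now apply incl_map.
Qed.

Lemma stratified_by_ren p : forall s r s',
  (forall i, s i = s' (r i)) -> stratified_by s p -> stratified_by s' (ren r p).
Proof.
  induction p; cbn; intros s r s' E; rewrite <- ?E; try tauto;
    try (intros [H1 H2]; split; eauto).
  - intros [i H]. exists i. eapply IHp; [|exact H]. intros [|j]; cbn; auto.
  - intros [i H]. exists i. eapply IHp; [|exact H]. intros [|j]; cbn; auto.
Qed.

(* Identifying variables may destroy stratification, hence the left inverse. *)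
Lemma INF_ren p r g : (forall i, g (r i) = i) -> INF p -> INF (ren r p).
Proof.
  intros E [|q [s Hs]]; [exact INF_ext|].
  cbn. replace (ren (up (up r)) (ren (up S) q)) with (ren (up S) (ren (up r) q)).
  - apply (INF_comp (ren (up r) q)). exists (fun i => s (up g i)).
    eapply stratified_by_ren; [|exact Hs].
    intros [|i]; cbn; [reflexivity|]. now rewrite E.
  - rewrite !ren_ren. apply ren_ext. intros [|i]; reflexivity.
Qed.

Lemma nd_ren G p : nd INF G p -> forall f g, (forall i, g (f i) = i) ->
  nd INF (map (ren f) G) (ren f p).
Proof.
  induction 1; intros f g E; cbn in *;
    try solve [econstructor; eauto].
  - apply nd_ax. now apply INF_ren with g.
  - apply nd_hyp. now apply in_map.
  - apply nd_allI. rewrite <- map_ren_shift. apply (IHnd (up f) (up g)).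
    intros [|i]; cbn; auto.
  - rewrite ren_inst. apply nd_allE. eauto.
  - apply nd_exI with (f x). rewrite <- ren_inst. eauto.
  - eapply nd_exE; [eauto|]. rewrite <- map_ren_shift, <- ren_shift.
    apply (IHnd2 (up f) (up g)). intros [|i]; cbn; auto.
  - rewrite ren_inst. apply nd_eqE with (f x); [eauto|].
    rewrite <- ren_inst. eauto.
Qed.

(** Turns [x] into the bound variable and makes room for it. Instantiation at [x] undoes this, which
    is the left inverse that [nd_ren] asks for. *)
Definition abs (x i : nat) : nat := if Nat.eqb i x then 0 else S i.

Lemma abs_inv x i : scons x (fun k => k) (abs x i) = i.
Proof. unfold abs. destruct (Nat.eqb_spec i x); auto. Qed.

Lemma ren_abs_below x p : fv_below x p -> ren (abs x) p = shift p.
Proof.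
  intro B. apply ren_ext_below with x; [exact B|]. intros i L. unfold abs.
  destruct (Nat.eqb_spec i x); [lia|reflexivity].
Qed.

Lemma map_abs_below x G : Forall (fv_below x) G -> map (ren (abs x)) G = map shift G.
Proof.
  intro B. apply map_ext_in. intros p I. apply ren_abs_below.
  rewrite Forall_forall in B. auto.
Qed.

Lemma abs_inst x p : fv_below (S x) p -> ren (abs x) (inst p x) = p.
Proof.
  intro B. unfold inst. rewrite ren_ren. transitivity (ren (fun i => i) p); [|now apply ren_id].
  apply ren_ext_below with (S x); [exact B|]. intros [|i] L; unfold abs; cbn.
  - now rewrite Nat.eqb_refl.
  - destruct (Nat.eqb_spec i x); [lia|reflexivity].
Qed.

(** The premise for a single [x] above all free variables suffices: renaming it to the bound
    variable gives the eigenvariable premise of [nd_allI]. *)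
Lemma nd_forall_intro G p : (forall x, nd INF G (inst p x)) -> nd INF G (All p).
Proof.
  intro H. destruct (ctx_below_exists (All p :: G)) as [x B].
  inversion_clear B as [|? ? Bp BG].
  apply nd_allI. rewrite <- (abs_inst x p Bp), <- (map_abs_below x G BG).
  exact (nd_ren _ _ (H x) _ _ (abs_inv x)).
Qed.

Lemma nd_exists_elim G p q : nd INF G (Ex p) ->
  (forall x, nd INF (inst p x :: G) q) -> nd INF G q.
Proof.
  intros He H. destruct (ctx_below_exists (Ex p :: q :: G)) as [x B].
  inversion_clear B as [|? ? Bp B']. inversion_clear B' as [|? ? Bq BG].
  eapply nd_exE; [exact He|].
  rewrite <- (ren_abs_below x q Bq), <- (abs_inst x p Bp), <- (map_abs_below x G BG).
  apply (nd_ren _ _ (H x) _ _ (abs_inv x)).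
Qed.

Definition env (l : list nat) (r : nat -> nat) : nat -> nat := fold_right scons r l.

Fixpoint alls (n : nat) (p : form) : form :=
  match n with 0 => p | S n => alls n (All p) end.

Lemma alls_intro n : forall p, (forall G, nd INF G p) -> forall G, nd INF G (alls n p).
Proof.
  induction n; intros p H; cbn; [exact H|]. apply IHn. intro G. apply nd_allI, H.
Qed.

Lemma alls_elim n : forall p r G,
  nd INF G (ren r (alls n p)) -> exists r', forall s, nd INF G (ren (fun i => if i <? n then s i else r' i) p).
Proof.
  induction n; intros p r G H; cbn in H.
  - exists r. intro s. exact H.
  (* The value at 0 is a default that is never read, since 0 lies below [S n]. *)
  - destruct (IHn _ _ _ H) as [r' H']. exists (fun i => match i with 0 => 0 | S j => r' j end). intro s.
    assert (H1 := H' (fun i => s (S i))). cbn in H1. apply nd_allE with (x := s 0) in H1.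
    rewrite inst_up in H1. erewrite ren_ext; [exact H1|].
    intros [|i]; [reflexivity|]. change (S i <? S n) with (i <? n). reflexivity.
Qed.

(* Goes through the universal closure of [p], so that [r] need not be injective as in [nd_ren]. *)
Lemma theorem_ren p r G : (forall G, nd INF G p) -> nd INF G (ren r p).
Proof.
  intro H. destruct (fv_below_exists p) as [n B].
  assert (Hn := alls_intro n p H G). rewrite <- (ren_id (alls n p) (fun i => i)) in Hn by auto.
  apply alls_elim in Hn as [r' Hr]. specialize (Hr r).
  erewrite ren_ext_below; [exact Hr|exact B|].
  intros i L. apply Nat.ltb_lt in L. cbv beta. now rewrite L.
Qed.

(** * Truth values *)

(** A truth value is a set of contexts that is closed under extension and under the
    disjunction and existence eliminations of the calculus. *)
#[local] Obligation Tactic := idtac.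

Record prop : Type := {
  force : list form -> Prop;
  mono : forall G G', incl G G' -> force G -> force G';
  stable : forall G,
    (forall G' q, incl G G' ->
       (forall G'', incl G' G'' -> force G'' -> nd INF G'' q) -> nd INF G' q) ->
    force G
}.

Notation "G ⊩ P" := (force P G) (at level 100, P at level 99, no associativity).

(** The second-order encoding of disjunction and existence, with [q] ranging over derivable formulas
    instead of all propositions. *)
Definition closure (A : list form -> Prop) (G : list form) : Prop :=
  forall G' q, incl G G' ->
    (forall G'', incl G' G'' -> A G'' -> nd INF G'' q) -> nd INF G' q.

Program Definition close (A : list form -> Prop) : prop := {| force := closure A |}.
Next Obligation.
  intros A G G' I H G'' q I'. apply H. eapply incl_tran; eauto.
Qed.
Next Obligation.
  intros A G H G' q I K. apply (H G' q I). intros G'' I' C.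
  apply (C G'' q (incl_refl _)). intros G3 I3. apply K. eapply incl_tran; eauto.
Qed.

Program Definition atom (p : form) : prop := {| force := fun G => nd INF G p |}.
Next Obligation. intros p G G' I H. cbn in *. eapply weakening; eauto. Qed.
Next Obligation. intros p G H. apply (H G p (incl_refl _)). auto. Qed.

Program Definition imp (P Q : prop) : prop :=
  {| force := fun G => forall G', incl G G' -> (G' ⊩ P) -> (G' ⊩ Q) |}.
Next Obligation. intros P Q G G' I H G'' I'. apply H. eapply incl_tran; eauto. Qed.
Next Obligation.
  intros P Q G H G' I HP. apply stable. intros G'' q I' K.
  apply (H G'' q); [eapply incl_tran; eauto|]. intros G3 I3 HI. apply K; [exact I3|].
  apply HI; [apply incl_refl|]. eapply mono; [|exact HP]. eapply incl_tran; eauto.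
Qed.

Program Definition conj (P Q : prop) : prop :=
  {| force := fun G => (G ⊩ P) /\ (G ⊩ Q) |}.
Next Obligation. intros P Q G G' I [H1 H2]. split; eapply mono; eauto. Qed.
Next Obligation.
  intros P Q G H. split; apply stable; intros G' q I K; apply (H G' q I);
    intros G'' I' [H1 H2]; auto.
Qed.

Program Definition all (P : nat -> prop) : prop :=
  {| force := fun G => forall x, G ⊩ P x |}.
Next Obligation. intros P G G' I H x. eapply mono; eauto. Qed.
Next Obligation.
  intros P G H x. apply stable. intros G' q I K. apply (H G' q I); auto.
Qed.

Definition disj (P Q : prop) : prop := close (fun G => (G ⊩ P) \/ (G ⊩ Q)).
Definition ex (P : nat -> prop) : prop := close (fun G => exists x, G ⊩ P x).
Definition iff (P Q : prop) : prop := conj (imp P Q) (imp Q P).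

Fixpoint sem (p : form) (r : nat -> nat) : prop :=
  match p with
  | Bot => atom Bot
  | Mem x y => atom (Mem (r x) (r y))
  | Eq x y => atom (Eq (r x) (r y))
  | Imp p q => imp (sem p r) (sem q r)
  | And p q => conj (sem p r) (sem q r)
  | Or p q => disj (sem p r) (sem q r)
  | All p => all (fun x => sem p (scons x r))
  | Ex p => ex (fun x => sem p (scons x r))
  end.

(** Each connective is matched by its introduction and elimination rules. Derivability of a
    universal formula needs a fresh variable, which [nd_forall_intro] extracts from the premises for
    all variables. *)
Lemma sem_nd p : forall r G, (G ⊩ sem p r) <-> nd INF G (ren r p).
Proof.
  induction p; intros r G; cbn; try tauto.
  - split.
    + intro H. apply nd_impI, IHp2, H; [apply incl_tl, incl_refl|].
      apply IHp1, nd_hyp. now left.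
    + intros H G' I HP. apply IHp2. apply nd_impE with (ren r p1); [|now apply IHp1].
      eapply weakening; eauto.
  - rewrite IHp1, IHp2. split.
    + intros [H1 H2]. now apply nd_andI.
    + intro H. split; [eapply nd_andE1|eapply nd_andE2]; eauto.
  - split.
    (* The closure is tested on the disjunction itself; the existential case does the same. *)
    + intro H. apply (H G (Or (ren r p1) (ren r p2)) (incl_refl _)).
      intros G' I [K|K]; [apply nd_orI1; now apply IHp1 | apply nd_orI2; now apply IHp2].
    + intros H G' q I K. apply nd_orE with (ren r p1) (ren r p2).
      * eapply weakening; eauto.
      * apply K; [apply incl_tl, incl_refl|]. left. apply IHp1, nd_hyp. now left.
      * apply K; [apply incl_tl, incl_refl|]. right. apply IHp2, nd_hyp. now left.
  - split.
    + intro H. apply nd_forall_intro. intro x. rewrite inst_up. now apply IHp.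
    + intros H x. apply IHp. rewrite <- inst_up. now apply nd_allE.
  - split.
    + intro H. apply (H G (Ex (ren (up r) p)) (incl_refl _)).
      intros G' I [x K]. apply nd_exI with x. rewrite inst_up. now apply IHp.
    + intros H G' q I K. apply nd_exists_elim with (ren (up r) p).
      * eapply weakening; eauto.
      * intro x. apply K; [apply incl_tl, incl_refl|]. exists x.
        apply IHp, nd_hyp. left. apply inst_up.
Qed.

Lemma sem_ren p r s G : (G ⊩ sem (ren r p) s) <-> (G ⊩ sem p (fun i => s (r i))).
Proof. rewrite !sem_nd, ren_ren. tauto. Qed.

Lemma sem_ext p r s G : (forall i, r i = s i) -> (G ⊩ sem p r) -> (G ⊩ sem p s).
Proof. intro E. rewrite !sem_nd, (ren_ext p r s E). auto. Qed.

Lemma imp_e {P Q G} : (G ⊩ imp P Q) -> (G ⊩ P) -> (G ⊩ Q).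
Proof. intros H. apply H, incl_refl. Qed.

Lemma iff_l {P Q G} : (G ⊩ iff P Q) -> (G ⊩ P) -> (G ⊩ Q).
Proof. intros [H _]. now apply imp_e. Qed.

Lemma iff_r {P Q G} : (G ⊩ iff P Q) -> (G ⊩ Q) -> (G ⊩ P).
Proof. intros [_ H]. now apply imp_e. Qed.

Lemma iff_i P Q G :
  (forall G', incl G G' -> (G' ⊩ P) <-> (G' ⊩ Q)) -> G ⊩ iff P Q.
Proof. intro H. split; intros G' I; apply H, I. Qed.

Lemma bot_e Q G : (G ⊩ atom Bot) -> G ⊩ Q.
Proof.
  intro H. apply stable. intros G' q I _. apply nd_botE. exact (weakening _ _ _ H _ I).
Qed.

Lemma close_e A Q G : (G ⊩ close A) ->
  (forall G', incl G G' -> A G' -> (G' ⊩ Q)) -> G ⊩ Q.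
Proof.
  intros H K. apply stable. intros G' q I K'. apply (H G' q I).
  intros G'' I' a. apply K'; [exact I'|]. apply K; [|exact a]. eapply incl_tran; eauto.
Qed.

Lemma close_i (A : list form -> Prop) G :
  (forall G', incl G G' -> A G') -> G ⊩ close A.
Proof. intros H G' q I K. apply K; [apply incl_refl|]. auto. Qed.

Lemma ex_e P Q G : (G ⊩ ex P) ->
  (forall G', incl G G' -> forall x, (G' ⊩ P x) -> (G' ⊩ Q)) -> G ⊩ Q.
Proof. intros H K. apply (close_e _ _ _ H). intros G' I [x Hx]. eauto. Qed.

Lemma ex_i P x G : (G ⊩ P x) -> G ⊩ ex P.
Proof. intro H. apply close_i. intros G' I. exists x. eapply mono; eauto. Qed.

Lemma or_e P Q R G : (G ⊩ disj P Q) ->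
  (forall G', incl G G' -> (G' ⊩ P) -> (G' ⊩ R)) ->
  (forall G', incl G G' -> (G' ⊩ Q) -> (G' ⊩ R)) -> G ⊩ R.
Proof. intros H K L. apply (close_e _ _ _ H). intros G' I [h|h]; eauto. Qed.

Lemma or_l {P Q G} : (G ⊩ P) -> G ⊩ disj P Q.
Proof. intro H. apply close_i. intros G' I. left. eapply mono; eauto. Qed.

Lemma or_r {P Q G} : (G ⊩ Q) -> G ⊩ disj P Q.
Proof. intro H. apply close_i. intros G' I. right. eapply mono; eauto. Qed.

(** * Comprehension and substitution *)

(** [p] defines the truth value [P], the free variables of [p] standing for
    the elements of [l]. *)
Definition rep (l : list nat) (p : form) (P : prop) : Prop :=
  forall r G, (G ⊩ P) <-> (G ⊩ sem p (env l r)).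

Inductive at_index (x : nat) : list nat -> nat -> Prop :=
| at_here l : at_index x (x :: l) 0
| at_there l y i : at_index x l i -> at_index x (y :: l) (S i).

Lemma at_index_env x l i r : at_index x l i -> env l r i = x.
Proof. induction 1; auto. Qed.

Lemma rep_bot l : rep l Bot (atom Bot).
Proof. intros r G. reflexivity. Qed.

Lemma rep_mem l x y i j :
  at_index x l i -> at_index y l j -> rep l (Mem i j) (atom (Mem x y)).
Proof.
  intros Hx Hy r G. cbn [sem]. rewrite (at_index_env _ _ _ _ Hx), (at_index_env _ _ _ _ Hy).
  reflexivity.
Qed.

Lemma rep_eq l x y i j :
  at_index x l i -> at_index y l j -> rep l (Eq i j) (atom (Eq x y)).
Proof.
  intros Hx Hy r G. cbn [sem]. rewrite (at_index_env _ _ _ _ Hx), (at_index_env _ _ _ _ Hy).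
  reflexivity.
Qed.

Lemma rep_imp l p q P Q : rep l p P -> rep l q Q -> rep l (Imp p q) (imp P Q).
Proof.
  intros HP HQ r G. cbn. split; intros H G' I K; apply (HQ r), H, (HP r), K; exact I.
Qed.

Lemma rep_and l p q P Q : rep l p P -> rep l q Q -> rep l (And p q) (conj P Q).
Proof. intros HP HQ r G. cbn. rewrite (HP r), (HQ r). reflexivity. Qed.

Lemma close_ext A B G : (forall G, A G <-> B G) -> (G ⊩ close A) <-> (G ⊩ close B).
Proof.
  intro E. split; intros H G' q I K; apply (H G' q I); intros G'' I' a; apply K; auto;
    now apply E.
Qed.

Lemma rep_or l p q P Q : rep l p P -> rep l q Q -> rep l (Or p q) (disj P Q).
Proof.
  intros HP HQ r G. apply close_ext. intro G'. rewrite (HP r), (HQ r). reflexivity.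
Qed.

Lemma rep_all l p P : (forall x, rep (x :: l) p (P x)) -> rep l (All p) (all P).
Proof. intros H r G. cbn. split; intros K x; apply (H x r), K. Qed.

Lemma rep_ex l p P : (forall x, rep (x :: l) p (P x)) -> rep l (Ex p) (ex P).
Proof.
  intros H r G. apply close_ext. intro G'. split; intros [x K]; exists x; apply (H x r), K.
Qed.

(** A Rocq function on variables need not respect equality of the object theory. One that is
    represented by a formula, uniformly in [x], does so by [nd_eqE]. *)
Lemma subst l p P x y G : (forall x, rep (x :: l) p (P x)) ->
  (G ⊩ atom (Eq x y)) -> (G ⊩ P x) -> (G ⊩ P y).
Proof.
  intros H E. rewrite (H x (fun i => i)), (H y (fun i => i)), !sem_nd. cbn.
  rewrite <- !inst_up. apply nd_eqE, E.
Qed.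

Lemma comprehension l p P G : (forall x, rep (x :: l) p (P x)) -> stratified p ->
  G ⊩ ex (fun X => all (fun x => iff (atom (Mem x X)) (P x))).
Proof.
  intros H st.
  (* Different parameters of [p] may stand for the same variable, so this renaming need not be
     injective. *)
  assert (A := theorem_ren _ (env l (fun i => i)) G (fun G => nd_ax INF G _ (INF_comp p st))).
  apply sem_nd in A. apply (ex_e _ _ _ A). clear A. intros G' I X K.
  apply ex_i with X. intro x. specialize (K x).
  change (G' ⊩ iff (atom (Mem x X))
    (sem (ren (up S) p) (scons x (scons X (env l (fun i => i)))))) in K.
  apply iff_i. intros G'' I'. apply (mono _ _ _ I') in K.
  rewrite (H x (fun i => i)). split; intro L.
  - apply (imp_e (proj1 K)) in L. apply (proj1 (sem_ren _ _ _ _)) in L. revert L. apply sem_ext.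
    intros [|i]; reflexivity.
  - apply (imp_e (proj2 K)). apply (proj2 (sem_ren _ _ _ _)). revert L. apply sem_ext.
    intros [|i]; reflexivity.
Qed.

Lemma stratified_intro l p : stratified_by (fun i => nth i l 0) p -> stratified p.
Proof. intro H. eexists. exact H. Qed.

(** * Vocabulary *)

(** The vocabulary of [Defs] with truth values in place of formulas. *)
Module Sem.

Inductive tm : Type :=
| Var : nat -> tm
| Cls : (nat -> prop) -> tm.

Definition compr (P : tm -> prop) : tm := Cls (fun x => P (Var x)).
Definition fall (P : tm -> prop) : prop := all (fun x => P (Var x)).
Definition fex (P : tm -> prop) : prop := ex (fun x => P (Var x)).

Definition has (b : tm) (x : nat) : prop :=
  match b with Var y => atom (Mem x y) | Cls P => P x end.

Definition eqt (a b : tm) : prop :=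
  match a, b with
  | Var x, Var y => atom (Eq x y)
  | _, _ => all (fun z => iff (has a z) (has b z))
  end.

Definition mem (a b : tm) : prop :=
  match a with
  | Var x => has b x
  | Cls _ => ex (fun z => conj (eqt (Var z) a) (has b z))
  end.

Declare Scope prop_scope.
Delimit Scope prop_scope with prop.
Bind Scope prop_scope with prop.
Bind Scope prop_scope with tm.
Open Scope prop_scope.

Notation "a ∈ b" := (mem a b) (at level 70, no associativity) : prop_scope.
Notation "a ≐ b" := (eqt a b) (at level 70, no associativity) : prop_scope.
Notation "¬ p" := (imp p (atom Bot)) (at level 75, right associativity) : prop_scope.
Notation "p ∧ q" := (conj p q) (at level 80, right associativity) : prop_scope.
Notation "p ∨ q" := (disj p q) (at level 85, right associativity) : prop_scope.
Notation "p ⇒ q" := (imp p q) (at level 90, right associativity) : prop_scope.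
Notation "p ⇔ q" := (iff p q) (at level 95, no associativity) : prop_scope.
Notation "∀ x .. y , p" := (fall (fun x => .. (fall (fun y => p)) ..))
  (at level 200, x binder, y binder, right associativity) : prop_scope.
Notation "∃ x .. y , p" := (fex (fun x => .. (fex (fun y => p)) ..))
  (at level 200, x binder, y binder, right associativity) : prop_scope.
Notation "⦃ x | p ⦄" := (compr (fun x => p))
  (at level 0, x name, p at level 200) : prop_scope.

Definition empty : tm := ⦃ x | atom Bot ⦄.
Definition sing (x : tm) : tm := ⦃ z | z ≐ x ⦄.
Definition upair (x y : tm) : tm := ⦃ z | z ≐ x ∨ z ≐ y ⦄.
Definition union (a b : tm) : tm := ⦃ z | z ∈ a ∨ z ∈ b ⦄.

Definition opair (x y : tm) : tm := upair (sing x) (upair x y).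

Definition triple (x y z : tm) : tm := opair (opair x y) (sing (sing z)).

Definition FUNC : tm :=
  ⦃ f | ∀ x y z, opair x y ∈ f ⇒ opair x z ∈ f ⇒ y ≐ z ⦄.

Definition Ap (f x : tm) : tm := ⦃ t | ∃ y, opair x y ∈ f ∧ t ∈ y ⦄.

Definition FINITE : tm :=
  ⦃ a | ∀ w,
      empty ∈ w ∧ (∀ x c, x ∈ w ∧ ¬ c ∈ x ⇒ union x (sing c) ∈ w) ⇒ a ∈ w ⦄.

Definition ident : tm := ⦃ u | ∃ x, x ≐ x ∧ u ≐ opair x x ⦄.

Definition zero : tm := ⦃ u | ∃ f, f ≐ f ∧ u ≐ opair f ident ⦄.

Definition succ_of (z : tm) : tm :=
  ⦃ v | ∃ f p, v ≐ opair f p ∧ f ∈ FUNC ∧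
      (∀ u, u ∈ p ⇔
         (∃ x w t q, u ≐ opair x w ∧ t ∈ FUNC ∧ opair f t ∈ z ∧
                     opair x q ∈ t ∧ opair q w ∈ f)) ⦄.

Definition SUCC : tm := ⦃ v | ∃ z, v ≐ opair z (succ_of z) ∧ z ∈ FUNC ⦄.

Definition succ (n : tm) : tm := Ap SUCC n.

Definition NN : tm :=
  ⦃ n | ∀ X, zero ∈ X ∧ (∀ u, u ∈ X ⇒ succ u ∈ X) ⇒ n ∈ X ⦄.

Definition Sum : tm :=
  ⦃ v | ∀ X,
      (∀ x, x ∈ NN ⇒ triple x zero x ∈ X) ∧
      (∀ x n y, x ∈ NN ∧ n ∈ NN ∧ y ∈ NN ⇒
         triple x n y ∈ X ⇒ triple x (succ n) (succ y) ∈ X) ⇒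
      v ∈ X ⦄.

Definition plus_is (x n y : tm) : prop :=
  (y ∈ NN ∧ triple x n y ∈ Sum) ∧
  (∀ y', y' ∈ NN ∧ triple x n y' ∈ Sum ⇒ y' ≐ y).

Definition lt (x y : tm) : prop := ∃ n, n ∈ NN ∧ plus_is x (succ n) y.

Definition double_successor (p : tm) : prop :=
  ∃ a b, a ∈ NN ∧ b ∈ NN ∧ ¬ a ≐ b ∧ p ≐ succ a ∧ p ≐ succ b.

Definition STEM : tm :=
  ⦃ s | s ∈ NN ∧ (∀ X,
      zero ∈ X ∧
      (∀ u, u ∈ NN ⇒
         u ∈ X ∧ (∀ v, v ∈ NN ⇒ succ v ≐ succ u ⇒ v ≐ u) ⇒ succ u ∈ X) ⇒
      s ∈ X) ⦄.

Definition fex_unique (P : tm -> prop) : prop :=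
  ∃ p, P p ∧ (∀ q, P q ⇒ q ≐ p).

Definition statement : prop :=
  NN ∈ FINITE ⇒
    ∀ k n,
      k ∈ STEM ∧ n ∈ NN ∧ ¬ k ≐ n ∧ succ k ≐ succ n ⇒
      fex_unique double_successor ∧
      (∀ j l,
         j ∈ NN ∧ l ∈ NN ∧ ¬ j ≐ l ∧ lt j l ∧ succ j ≐ succ l ⇒
         j ≐ k ∧ l ≐ n).

End Sem.

(** * Truth values of formulas with named binders *)

(** A scope is a depth with the values of the levels below it. *)
Definition scope : Type := (nat * (nat -> nat))%type.

(** Levels count from the outermost binder, indices from the innermost. An index at or beyond the
    depth belongs to a free variable, which denotes itself once the depth is subtracted. *)
Definition values (w : scope) (i : nat) : nat :=
  if i <? fst w then snd w (fst w - S i) else i - fst w.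

Definition extends (w w' : scope) : Prop :=
  fst w <= fst w' /\ forall l, l < fst w -> snd w' l = snd w l.

Definition bind (x : nat) (w : scope) : scope :=
  (S (fst w), fun l => if l =? fst w then x else snd w l).

(** Quantifying over extended scopes, as in a Kripke model, makes a denotation usable under further
    binders. *)
Definition denotes (w : scope) (p : fm) (P : prop) : Prop :=
  forall w', extends w w' ->
  forall G, (G ⊩ P) <-> (G ⊩ sem (p (fst w')) (values w')).

Definition denotes_tm (w : scope) (a : tm) (b : Sem.tm) : Prop :=
  match a, b with
  | Var l, Sem.Var x => l < fst w /\ snd w l = x
  | Cls F, Sem.Cls Q => forall w', extends w w' ->
      forall l, l < fst w' -> denotes w' (F l) (Q (snd w' l))
  | _, _ => False
  end.

Definition denotes_fun (w : scope) (F : tm -> fm) (Q : Sem.tm -> prop) : Prop :=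
  forall w', extends w w' ->
  forall a b, denotes_tm w' a b -> denotes w' (F a) (Q b).

Lemma extends_refl w : extends w w.
Proof. split; auto. Qed.

Lemma extends_trans w1 w2 w3 : extends w1 w2 -> extends w2 w3 -> extends w1 w3.
Proof.
  intros [L E] [L' E']. split; [lia|]. intros l H. rewrite E', E by lia. reflexivity.
Qed.

Lemma extends_bind x w : extends w (bind x w).
Proof.
  split; cbn; [lia|]. intros l H. destruct (Nat.eqb_spec l (fst w)); [lia|reflexivity].
Qed.

Lemma denotes_tm_mono w w' a b : extends w w' -> denotes_tm w a b -> denotes_tm w' a b.
Proof.
  destruct a, b; cbn; try tauto.
  - intros [L E] [L' E']. rewrite E by exact L'. split; [lia|exact E'].
  - intros E H w'' E'. apply H. eapply extends_trans; eauto.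
Qed.

Lemma denotes_fun_mono w w' F Q :
  extends w w' -> denotes_fun w F Q -> denotes_fun w' F Q.
Proof. intros E H w'' E'. apply H. eapply extends_trans; eauto. Qed.

Lemma values_bind x w i : values (bind x w) i = scons x (values w) i.
Proof.
  destruct i as [|i]; unfold values; cbn [bind fst snd scons].
  - cbn. now rewrite Nat.sub_0_r, Nat.eqb_refl.
  - change (S i <? S (fst w)) with (i <? fst w). rewrite Nat.sub_succ.
    destruct (Nat.ltb_spec i (fst w)); [|reflexivity].
    destruct (Nat.eqb_spec (fst w - S i) (fst w)); [lia|reflexivity].
Qed.

Lemma values_ix w l : l < fst w -> values w (ix (fst w) l) = snd w l.
Proof.
  intro L. unfold values, ix. destruct (Nat.ltb_spec (fst w - S l) (fst w)); [|lia].
  f_equal. lia.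
Qed.

Lemma denotes_bot w : denotes w fbot (atom Bot).
Proof. intros w' E G. reflexivity. Qed.

Lemma denotes_imp w p q P Q :
  denotes w p P -> denotes w q Q -> denotes w (fimp p q) (imp P Q).
Proof.
  intros HP HQ w' E G. cbn.
  split; intros H G' I K; apply (HQ w' E), H, (HP w' E), K; exact I.
Qed.

Lemma denotes_and w p q P Q :
  denotes w p P -> denotes w q Q -> denotes w (fconj p q) (conj P Q).
Proof. intros HP HQ w' E G. cbn. rewrite (HP w' E), (HQ w' E). reflexivity. Qed.

Lemma denotes_or w p q P Q :
  denotes w p P -> denotes w q Q -> denotes w (fdisj p q) (disj P Q).
Proof.
  intros HP HQ w' E G. apply close_ext. intro G'. rewrite (HP w' E), (HQ w' E). reflexivity.
Qed.

Lemma denotes_iff w p q P Q :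
  denotes w p P -> denotes w q Q -> denotes w (fiff p q) (iff P Q).
Proof. intros HP HQ. apply denotes_and; apply denotes_imp; assumption. Qed.

Lemma denotes_body w w' x F Q G : extends w w' ->
  (forall w'', extends w w'' -> forall l, l < fst w'' -> denotes w'' (F l) (Q (snd w'' l))) ->
  (G ⊩ Q x) <-> (G ⊩ sem (F (fst w') (S (fst w'))) (scons x (values w'))).
Proof.
  intros E H. assert (D := extends_bind x w').
  assert (K := H _ (extends_trans _ _ _ E D) (fst w') (Nat.lt_succ_diag_r _) _ (extends_refl _) G).
  cbn in K. rewrite Nat.eqb_refl in K. rewrite K.
  split; apply sem_ext; intro i; [|symmetry]; apply (values_bind x w').
Qed.

Lemma denotes_fall w F Q : denotes_fun w F Q -> denotes w (fall F) (Sem.fall Q).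
Proof.
  intros H w' E G. cbn.
  assert (B := fun x G => denotes_body w w' x (fun l => F (Var l)) (fun x => Q (Sem.Var x)) G E
    (fun w'' E' l L => H w'' E' (Var l) (Sem.Var _) (Logic.conj L eq_refl))).
  split; intros K x; apply B, K.
Qed.

Lemma denotes_fex w F Q : denotes_fun w F Q -> denotes w (fex F) (Sem.fex Q).
Proof.
  intros H w' E G. apply close_ext. intro G'.
  assert (B := fun x G => denotes_body w w' x (fun l => F (Var l)) (fun x => Q (Sem.Var x)) G E
    (fun w'' E' l L => H w'' E' (Var l) (Sem.Var _) (Logic.conj L eq_refl))).
  split; intros [x K]; exists x; apply B, K.
Qed.

Lemma denotes_compr w F Q : denotes_fun w F Q -> denotes_tm w (compr F) (Sem.compr Q).
Proof. intros H w' E l L. apply H; [exact E|]. now split. Qed.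

Lemma denotes_has w b c l :
  denotes_tm w b c -> l < fst w -> denotes w (has b l) (Sem.has c (snd w l)).
Proof.
  destruct b as [y|F], c as [z|Q]; cbn; try tauto.
  - intros [L <-] L' w' E G. cbn. destruct E as [Le E].
    rewrite !values_ix, !E by lia. reflexivity.
  - intros H L. apply H; [apply extends_refl|exact L].
Qed.

Lemma denotes_same w a b c d : denotes_tm w a c -> denotes_tm w b d ->
  denotes w (fun d => All (Iff (has a d (S d)) (has b d (S d))))
    (all (fun z => iff (Sem.has c z) (Sem.has d z))).
Proof.
  intros Ha Hb.
  (* The formula is a [fall] in disguise. The branches for class abstracts are dummies, since [fall]
     supplies only variables. *)
  apply (denotes_fall w
    (fun t => match t with Var l => fiff (has a l) (has b l) | _ => fbot end)
    (fun t => match t with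
              | Sem.Var z => iff (Sem.has c z) (Sem.has d z)
              | _ => atom Bot end)).
  intros w' E [l|F] [z|Q]; cbn; try tauto; [|intros _; apply denotes_bot].
  intros [L <-]. apply denotes_iff; apply denotes_has; auto;
    eapply denotes_tm_mono; eauto.
Qed.

Lemma denotes_eqt w a b c d :
  denotes_tm w a c -> denotes_tm w b d -> denotes w (eqt a b) (Sem.eqt c d).
Proof.
  destruct a as [x|F], c as [u|P]; try (cbn; tauto);
    destruct b as [y|F'], d as [v|P']; try (cbn; tauto);
    intros Ha Hb; try exact (denotes_same _ _ _ _ _ Ha Hb).
  cbn in *. destruct Ha as [L1 <-], Hb as [L2 <-]. intros w' [Le E] G. cbn.
  rewrite !values_ix, !E by lia. reflexivity.
Qed.

Lemma denotes_mem w a b c d :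
  denotes_tm w a c -> denotes_tm w b d -> denotes w (mem a b) (Sem.mem c d).
Proof.
  destruct a as [x|F], c as [u|P]; try (cbn; tauto); intros Ha Hb.
  - cbn in Ha. destruct Ha as [L <-]. now apply denotes_has.
  - apply (denotes_fex w
      (fun t => match t with Var l => fconj (eqt t (Cls F)) (has b l) | _ => fbot end)
      (fun t => match t with
                | Sem.Var z => conj (Sem.eqt t (Sem.Cls P)) (Sem.has d z)
                | _ => atom Bot end)).
    intros w' E [l|F'] [z|Q]; try (cbn; tauto); [|intros _; apply denotes_bot].
    intro H. assert (L := H). destruct L as [L <-]. apply denotes_and.
    + apply denotes_eqt; [exact H|]. now apply (denotes_tm_mono w w' _ _ E).
    + apply denotes_has; [|exact L]. now apply (denotes_tm_mono w w' _ _ E).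
Qed.

Create HintDb denotation.

Ltac denotation :=
  repeat match goal with
  | |- denotes_fun ?v _ _ =>
      let w := fresh "w" in let E := fresh "E" in
      intros w E ? ? ?;
      repeat match goal with
      | H : denotes_tm v _ _ |- _ => apply (denotes_tm_mono _ _ _ _ E) in H
      | H : denotes_fun v _ _ |- _ => apply (denotes_fun_mono _ _ _ _ E) in H
      end; clear E
  | H : denotes_fun ?w ?F ?Q |- denotes ?w (?F _) (?Q _) => apply (H w (extends_refl w))
  | |- denotes _ _ _ =>
      first [ apply denotes_bot | apply denotes_imp | apply denotes_and | apply denotes_or
            | apply denotes_iff | apply denotes_fall | apply denotes_fex
            | apply denotes_eqt | apply denotes_mem | solve [auto 9 with denotation]]
  | |- denotes_tm _ _ _ =>
      first [ assumption | solve [auto 9 with denotation] | apply denotes_compr ]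
  end.

Lemma denotes_empty w :
  denotes_tm w empty Sem.empty.
Proof. intros. unfold empty, Sem.empty. denotation. Qed.
#[local] Hint Resolve denotes_empty : denotation.

Lemma denotes_sing w a a' :
  denotes_tm w a a' -> denotes_tm w (sing a) (Sem.sing a').
Proof. intros. unfold sing, Sem.sing. denotation. Qed.
#[local] Hint Resolve denotes_sing : denotation.

Lemma denotes_upair w a a' b b' :
  denotes_tm w a a' -> denotes_tm w b b' -> denotes_tm w (upair a b) (Sem.upair a' b').
Proof. intros. unfold upair, Sem.upair. denotation. Qed.
#[local] Hint Resolve denotes_upair : denotation.

Lemma denotes_union w a a' b b' :
  denotes_tm w a a' -> denotes_tm w b b' -> denotes_tm w (union a b) (Sem.union a' b').
Proof. intros. unfold union, Sem.union. denotation. Qed.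
#[local] Hint Resolve denotes_union : denotation.

Lemma denotes_opair w a a' b b' :
  denotes_tm w a a' -> denotes_tm w b b' -> denotes_tm w (opair a b) (Sem.opair a' b').
Proof. intros. unfold opair, Sem.opair. denotation. Qed.
#[local] Hint Resolve denotes_opair : denotation.

Lemma denotes_triple w a a' b b' c c' :
  denotes_tm w a a' -> denotes_tm w b b' -> denotes_tm w c c' -> denotes_tm w (triple a b c) (Sem.triple a' b' c').
Proof. intros. unfold triple, Sem.triple. denotation. Qed.
#[local] Hint Resolve denotes_triple : denotation.

Lemma denotes_FUNC w :
  denotes_tm w FUNC Sem.FUNC.
Proof. intros. unfold FUNC, Sem.FUNC. denotation. Qed.
#[local] Hint Resolve denotes_FUNC : denotation.

Lemma denotes_Ap w a a' b b' :
  denotes_tm w a a' -> denotes_tm w b b' -> denotes_tm w (Ap a b) (Sem.Ap a' b').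
Proof. intros. unfold Ap, Sem.Ap. denotation. Qed.
#[local] Hint Resolve denotes_Ap : denotation.

Lemma denotes_FINITE w :
  denotes_tm w FINITE Sem.FINITE.
Proof. intros. unfold FINITE, Sem.FINITE. denotation. Qed.
#[local] Hint Resolve denotes_FINITE : denotation.

Lemma denotes_ident w :
  denotes_tm w ident Sem.ident.
Proof. intros. unfold ident, Sem.ident. denotation. Qed.
#[local] Hint Resolve denotes_ident : denotation.

Lemma denotes_zero w :
  denotes_tm w zero Sem.zero.
Proof. intros. unfold zero, Sem.zero. denotation. Qed.
#[local] Hint Resolve denotes_zero : denotation.

Lemma denotes_succ_of w a a' :
  denotes_tm w a a' -> denotes_tm w (succ_of a) (Sem.succ_of a').
Proof. intros. unfold succ_of, Sem.succ_of. denotation. Qed.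
#[local] Hint Resolve denotes_succ_of : denotation.

Lemma denotes_SUCC w :
  denotes_tm w SUCC Sem.SUCC.
Proof. intros. unfold SUCC, Sem.SUCC. denotation. Qed.
#[local] Hint Resolve denotes_SUCC : denotation.

Lemma denotes_succ w a a' :
  denotes_tm w a a' -> denotes_tm w (succ a) (Sem.succ a').
Proof. intros. unfold succ, Sem.succ. denotation. Qed.
#[local] Hint Resolve denotes_succ : denotation.

Lemma denotes_NN w :
  denotes_tm w NN Sem.NN.
Proof. intros. unfold NN, Sem.NN. denotation. Qed.
#[local] Hint Resolve denotes_NN : denotation.

Lemma denotes_Sum w :
  denotes_tm w Sum Sem.Sum.
Proof. intros. unfold Sum, Sem.Sum. denotation. Qed.
#[local] Hint Resolve denotes_Sum : denotation.

Lemma denotes_plus_is w a a' b b' c c' :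
  denotes_tm w a a' -> denotes_tm w b b' -> denotes_tm w c c' -> denotes w (plus_is a b c) (Sem.plus_is a' b' c').
Proof. intros. unfold plus_is, Sem.plus_is. denotation. Qed.
#[local] Hint Resolve denotes_plus_is : denotation.

Lemma denotes_lt w a a' b b' :
  denotes_tm w a a' -> denotes_tm w b b' -> denotes w (lt a b) (Sem.lt a' b').
Proof. intros. unfold lt, Sem.lt. denotation. Qed.
#[local] Hint Resolve denotes_lt : denotation.

Lemma denotes_double_successor w a a' :
  denotes_tm w a a' -> denotes w (double_successor a) (Sem.double_successor a').
Proof. intros. unfold double_successor, Sem.double_successor. denotation. Qed.
#[local] Hint Resolve denotes_double_successor : denotation.

Lemma denotes_STEM w :
  denotes_tm w STEM Sem.STEM.
Proof. intros. unfold STEM, Sem.STEM. denotation. Qed.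
#[local] Hint Resolve denotes_STEM : denotation.

Lemma denotes_fex_unique w F Q :
  denotes_fun w F Q -> denotes w (fex_unique F) (Sem.fex_unique Q).
Proof. intros. unfold fex_unique, Sem.fex_unique. denotation. Qed.

Lemma denotes_closed p P :
  denotes (0, fun l => l) p P -> (forall G, G ⊩ P) -> nd INF nil (closed p).
Proof.
  intros D H. unfold closed. rewrite <- (ren_id (p 0) (values (0, fun l => l))).
  - apply sem_nd, (D _ (extends_refl _)), H.
  - intro i. apply Nat.sub_0_r.
Qed.

(** * Reasoning with truth values *)

Module Internal.

Import Sem.
Open Scope prop_scope.

(* A step that extends the context [G] to [G'] carries all hypotheses along, so that proofs speak
   about a single current context. *)
Ltac weaken G G' I :=
  repeat match goal with
  | H : force ?P G |- _ => apply (mono P _ _ I) in H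
  end; clear I; try (clear G; rename G' into G).

Ltac assume H :=
  lazymatch goal with |- force _ ?G =>
    let G' := fresh "G" in let I := fresh "I" in
    intros G' I; weaken G G' I; intro H; cbv beta in H
  end.

Ltac ex_elim H x K :=
  lazymatch type of H with force _ ?G =>
    apply (ex_e _ _ _ H); clear H;
    let G' := fresh "G" in let I := fresh "I" in
    intros G' I x K; cbv beta in K; weaken G G' I
  end.

Ltac or_elim H :=
  lazymatch type of H with force _ ?G =>
    apply (or_e _ _ _ _ H); clear H;
    let G' := fresh "G" in let I := fresh "I" in
    intros G' I H; cbv beta in H; weaken G G' I
  end.

Ltac variables l :=
  match goal with
  | x : nat |- _ =>
      lazymatch l with context [cons x _] => fail | _ => variables (cons x l) end
  | _ => l
  end.

Definition rel (R x y : nat) : prop := opair (Var x) (Var y) ∈ Var R.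

(** The reflexive transitive closure of [R], written in the shape of [NN] so that N becomes the
    orbit of zero. It is stratified with [x] and [y] at equal index, three below that of [R]. *)
Definition orb (R x y : nat) : prop :=
  ∀ X, Var x ∈ X ∧ (∀ u v, u ∈ X ⇒ opair u v ∈ Var R ⇒ v ∈ X) ⇒ Var y ∈ X.

Definition decided (x y : nat) : prop := Var x ≐ Var y ∨ ¬ Var x ≐ Var y.

(** The representing formula is an evar: applying the rules builds it from the shape of the truth
    value, and variables become positions in the parameter list. *)
Ltac reify :=
  cbv beta iota delta [fall fex has eqt mem compr iff empty sing upair union opair triple
    FUNC Ap ident zero succ_of SUCC rel orb decided];
  repeat lazymatch goal with
  | |- rep _ _ (imp _ _) => apply rep_imp
  | |- rep _ _ (conj _ _) => apply rep_and
  | |- rep _ _ (disj _ _) => apply rep_or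
  | |- rep _ _ (all _) => apply rep_all; intro
  | |- rep _ _ (ex _) => apply rep_ex; intro
  | |- rep _ _ (atom Bot) => apply rep_bot
  | |- rep _ _ (atom (Mem _ _)) => apply rep_mem
  | |- rep _ _ (atom (Eq _ _)) => apply rep_eq
  | |- at_index ?x (?x :: _) _ => apply at_here
  | |- at_index _ _ _ => apply at_there
  end.

Ltac unknowns l :=
  lazymatch l with
  | nil => uconstr:(nil)
  | cons _ ?l => let u := unknowns l in uconstr:(cons _ u)
  end.

(* The indices are found by unification, each equation relating two of them by an offset; those
   left undetermined become 0. *)
Ltac stratify l :=
  let u := unknowns l in
  unshelve (
    eapply (stratified_intro (cons _ u));
    cbn [stratified_by];
    repeat lazymatch goal with
    | |- True => exact Logic.I
    | |- _ /\ _ => split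
    | |- exists _, _ => eexists
    | |- _ = _ => cbn [scons nth]; reflexivity
    end); exact 0.

Ltac comprehend P X K :=
  lazymatch goal with |- force _ ?G =>
    let l := variables (@nil nat) in
    let H := fresh "H" in
    assert (H : G ⊩ ex (fun X => all (fun x => iff (atom (Mem x X)) (P x))));
    [ eapply (comprehension l); [intro; reify | stratify l] | ex_elim H X K ]
  end.

Ltac subst_in E H :=
  lazymatch type of E with
  | force (eqt (Var ?x) (Var ?y)) ?G =>
    lazymatch type of H with force ?Q G =>
      let F := eval pattern x in Q in
      lazymatch F with ?P _ =>
        let l := variables (@nil nat) in
        let T := eval cbv beta in (P y) in
        let H' := fresh "H" in
        assert (H' : force T G)
          by (eapply (subst l _ P x y G); [intro; reify | exact E | exact H]);
        clear H; rename H' into H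
      end
    end
  end.

(** * Sets and classes *)

Lemma eq_refl x G : G ⊩ Var x ≐ Var x.
Proof. apply nd_eqI. Qed.

Lemma eq_sym {x y G} : (G ⊩ Var x ≐ Var y) -> G ⊩ Var y ≐ Var x.
Proof.
  intro E. eapply (subst (x :: nil) _ (fun z => Var z ≐ Var x));
    [intro; reify | exact E | apply eq_refl].
Qed.

Lemma eq_trans {x y z G} :
  (G ⊩ Var x ≐ Var y) -> (G ⊩ Var y ≐ Var z) -> G ⊩ Var x ≐ Var z.
Proof. intros E H. subst_in H E. exact E. Qed.

Lemma iff_refl P G : G ⊩ iff P P.
Proof. apply iff_i. reflexivity. Qed.

Lemma iff_sym P Q G : (G ⊩ iff P Q) -> G ⊩ iff Q P.
Proof. intros [H K]. now split. Qed.

Lemma iff_force {P Q G} : (G ⊩ iff P Q) -> (G ⊩ P) <-> (G ⊩ Q).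
Proof. intro H. split; [now apply iff_l | now apply iff_r]. Qed.

Lemma iff_trans P Q R G : (G ⊩ iff P Q) -> (G ⊩ iff Q R) -> G ⊩ iff P R.
Proof.
  intros H K. apply iff_i. intros G' I. weaken G G' I.
  rewrite (iff_force H). now apply iff_force.
Qed.

Lemma iff_conj P P' Q Q' G :
  (G ⊩ iff P P') -> (G ⊩ iff Q Q') -> G ⊩ iff (conj P Q) (conj P' Q').
Proof.
  intros H K. apply iff_i. intros G' I. weaken G G' I. cbn.
  now rewrite (iff_force H), (iff_force K).
Qed.

Lemma iff_disj P P' Q Q' G :
  (G ⊩ iff P P') -> (G ⊩ iff Q Q') -> G ⊩ iff (disj P Q) (disj P' Q').
Proof.
  intros H K. apply iff_i. intros G' I. weaken G G' I.
  split; intro L; or_elim L.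
  - apply or_l. now apply (iff_l H).
  - apply or_r. now apply (iff_l K).
  - apply or_l. now apply (iff_r H).
  - apply or_r. now apply (iff_r K).
Qed.

Lemma iff_imp P P' Q Q' G :
  (G ⊩ iff P P') -> (G ⊩ iff Q Q') -> G ⊩ iff (imp P Q) (imp P' Q').
Proof.
  intros H K. apply iff_i. intros G' I. weaken G G' I.
  split; intro L; assume N.
  - apply (iff_l K), (imp_e L), (iff_r H), N.
  - apply (iff_r K), (imp_e L), (iff_l H), N.
Qed.

Lemma iff_all P P' G :
  (forall x, G ⊩ iff (P x) (P' x)) -> G ⊩ iff (all P) (all P').
Proof.
  intro H. apply iff_i. intros G' I.
  split; intros L x; [apply (iff_l (mono _ _ _ I (H x))) | apply (iff_r (mono _ _ _ I (H x)))]; apply L.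
Qed.

Lemma iff_ex P P' G :
  (forall x, G ⊩ iff (P x) (P' x)) -> G ⊩ iff (ex P) (ex P').
Proof.
  intro H. change (G ⊩ all (fun x => iff (P x) (P' x))) in H.
  apply iff_i. intros G' I. weaken G G' I.
  split; intro L; ex_elim L x K; apply ex_i with x.
  - exact (iff_l (H x) K).
  - exact (iff_r (H x) K).
Qed.

Definition same (a b : tm) : prop := all (fun z => iff (has a z) (has b z)).

Lemma same_refl a G : G ⊩ same a a.
Proof. intro z. apply iff_refl. Qed.

Lemma same_sym a b G : (G ⊩ same a b) -> G ⊩ same b a.
Proof. intros H z. apply iff_sym, H. Qed.

Lemma same_trans a b c G : (G ⊩ same a b) -> (G ⊩ same b c) -> G ⊩ same a c.
Proof. intros H K z. eapply iff_trans; [apply H|apply K]. Qed.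

(** True by definition unless both sides are variables; then one direction is substitution and the
    other is the axiom of extensionality. *)
Lemma eqt_same a b G : (G ⊩ a ≐ b) <-> (G ⊩ same a b).
Proof.
  destruct a as [x|P], b as [y|Q]; try reflexivity.
  split; intro H.
  - intro z. assert (K := iff_refl (has (Var x) z) G).
    eapply (subst (x :: z :: nil) _ (fun y => iff (has (Var x) z) (has (Var y) z)));
      [intro; reify | exact H | exact K].
  - assert (A : G ⊩ sem (All (All (Imp (All (Iff (Mem 0 2) (Mem 0 1))) (Eq 1 0)))) (fun i => i)).
    { apply sem_nd. apply nd_ax. apply INF_ext. }
    apply (imp_e (A x y)). exact H.
Qed.

Lemma eqt_cong {a a' b b' G} :
  (G ⊩ same a a') -> (G ⊩ same b b') -> G ⊩ iff (a ≐ b) (a' ≐ b').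
Proof.
  intros H K. apply iff_i. intros G' I. weaken G G' I. rewrite !eqt_same.
  split; intro L.
  - eapply same_trans; [apply same_sym, H|]. eapply same_trans; eauto.
  - eapply same_trans; [apply H|]. eapply same_trans; [|apply same_sym]; eauto.
Qed.

Lemma mem_set a X G : G ⊩ iff (a ∈ Var X) (ex (fun z => Var z ≐ a ∧ Var z ∈ Var X)).
Proof.
  destruct a as [x|P]; [|apply iff_refl].
  apply iff_i. intros G' _. split; intro H.
  - apply ex_i with x. split; [apply eq_refl | exact H].
  - ex_elim H z K. destruct K as [E K]. subst_in E K. exact K.
Qed.

Lemma mem_cong a b X G :
  (G ⊩ same a b) -> G ⊩ iff (a ∈ Var X) (b ∈ Var X).
Proof.
  intro H. eapply iff_trans; [apply mem_set|]. eapply iff_trans; [|apply iff_sym, mem_set].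
  apply iff_ex. intro z. apply iff_conj; [|apply iff_refl].
  apply eqt_cong; [apply same_refl|exact H].
Qed.

Lemma sing_cong a a' G : (G ⊩ same a a') -> G ⊩ same (sing a) (sing a').
Proof. intros H z. apply (eqt_cong (a := Var z) (a' := Var z)); [apply same_refl|exact H]. Qed.

Lemma upair_cong a a' b b' G :
  (G ⊩ same a a') -> (G ⊩ same b b') -> G ⊩ same (upair a b) (upair a' b').
Proof.
  intros H K z. apply iff_disj; apply (eqt_cong (a := Var z) (a' := Var z)); auto using same_refl.
Qed.

Lemma opair_cong {a a' b b' G} :
  (G ⊩ same a a') -> (G ⊩ same b b') -> G ⊩ same (opair a b) (opair a' b').
Proof. intros H K. apply upair_cong; [apply sing_cong | apply upair_cong]; auto. Qed.

Lemma triple_cong {a a' b b' c c' G} :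
  (G ⊩ same a a') -> (G ⊩ same b b') -> (G ⊩ same c c') ->
  G ⊩ same (triple a b c) (triple a' b' c').
Proof. intros. apply opair_cong; [apply opair_cong | apply sing_cong, sing_cong]; auto. Qed.

(** A class abstract need not exist as a set. The singleton of one that does not is empty, so
    injectivity of singletons and pairs holds only under this condition. *)
Definition is_set (a : tm) : prop := ex (fun u => Var u ≐ a).

Lemma is_set_var x G : G ⊩ is_set (Var x).
Proof. apply ex_i with x, eq_refl. Qed.

Lemma is_set_same a b G : (G ⊩ same a b) -> (G ⊩ is_set a) -> G ⊩ is_set b.
Proof.
  intros H K. revert K. apply iff_l, iff_ex. intro u. apply eqt_cong; [apply same_refl|exact H].
Qed.

Lemma is_set_upair a b G : (G ⊩ is_set a) -> (G ⊩ is_set b) -> G ⊩ is_set (upair a b).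
Proof.
  intros H K. ex_elim H x E. ex_elim K y F. rewrite eqt_same in E, F.
  apply (is_set_same (upair (Var x) (Var y)));
    [now apply upair_cong|].
  clear E F. comprehend (fun z => Var z ≐ Var x ∨ Var z ≐ Var y) u Hu.
  apply ex_i with u. exact Hu.
Qed.

Lemma is_set_sing a G : (G ⊩ is_set a) -> G ⊩ is_set (sing a).
Proof.
  intro H. apply (is_set_same (upair a a)); [|now apply is_set_upair].
  intro z. apply iff_i. intros G' _. split; intro K.
  - or_elim K; exact K.
  - now apply or_l.
Qed.

Lemma is_set_opair a b G : (G ⊩ is_set a) -> (G ⊩ is_set b) -> G ⊩ is_set (opair a b).
Proof. intros H K. apply is_set_upair; [apply is_set_sing | apply is_set_upair]; auto. Qed.

Lemma is_set_triple a b c G :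
  (G ⊩ is_set a) -> (G ⊩ is_set b) -> (G ⊩ is_set c) -> G ⊩ is_set (triple a b c).
Proof. intros. apply is_set_opair; [apply is_set_opair | apply is_set_sing, is_set_sing]; auto. Qed.

Lemma eqt_sym {a b G} : (G ⊩ a ≐ b) -> G ⊩ b ≐ a.
Proof. rewrite !eqt_same. apply same_sym. Qed.

Lemma eqt_trans {a b c G} : (G ⊩ a ≐ b) -> (G ⊩ b ≐ c) -> G ⊩ a ≐ c.
Proof. rewrite !eqt_same. apply same_trans. Qed.

Lemma sing_inj a b G : (G ⊩ is_set a) -> (G ⊩ sing a ≐ sing b) -> G ⊩ a ≐ b.
Proof.
  intros H K. ex_elim H x E. eapply eqt_trans; [apply eqt_sym, E|].
  exact (iff_l (K x) E).
Qed.

(** Both elements of the left pair exist as sets, hence can be tested for membership in the right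
    pair. *)
Lemma opair_parts a b c d G : (G ⊩ is_set a) -> (G ⊩ is_set b) ->
  (G ⊩ opair a b ≐ opair c d) ->
  (G ⊩ sing a ≐ sing c ∨ sing a ≐ upair c d) /\ (G ⊩ upair a b ≐ sing c ∨ upair a b ≐ upair c d).
Proof.
  intros Ha Hb H.
  assert (S1 := is_set_sing _ _ Ha). assert (S2 := is_set_upair _ _ _ Ha Hb).
  split; [ex_elim S1 s Hs | ex_elim S2 s Hs];
    [ assert (K := iff_l (H s) (or_l Hs))
    | assert (K := iff_l (H s) (or_r Hs)) ];
    cbn [has upair compr] in K; or_elim K;
    (apply or_l + apply or_r); eapply eqt_trans; (apply eqt_sym; exact Hs) || exact K.
Qed.

Lemma opair_inj_var x y u v G : (G ⊩ opair (Var x) (Var y) ≐ opair (Var u) (Var v)) ->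
  (G ⊩ Var x ≐ Var u) /\ (G ⊩ Var y ≐ Var v).
Proof.
  intro H.
  assert (Sx := is_set_var x G). assert (Sy := is_set_var y G).
  assert (Su := is_set_var u G). assert (Sv := is_set_var v G).
  destruct (opair_parts _ _ _ _ _ Sx Sy H) as [P1 P2].
  destruct (opair_parts _ _ _ _ _ Su Sv (eqt_sym H)) as [_ P4].
  clear Sx Sy Su Sv H.
  assert (E : G ⊩ Var x ≐ Var u).
  { or_elim P1.
    - exact (iff_l (P1 x) (eq_refl x _)).
    - exact (eq_sym (iff_r (P1 u) (or_l (eq_refl u _)))). }
  split; [exact E|]. clear P1.
  assert (B : G ⊩ Var y ≐ Var u ⇒ Var v ≐ Var x ∨ Var v ≐ Var y ⇒ Var y ≐ Var v).
  { assume F. assume K. or_elim K.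
    - eapply eq_trans; [exact F|]. apply eq_sym. eapply eq_trans; eauto.
    - now apply eq_sym. }
  or_elim P2.
  - assert (F := iff_l (P2 y) (or_r (eq_refl y _)) : _ ⊩ Var y ≐ Var u).
    apply (imp_e (imp_e B F)). or_elim P4.
    + apply or_l. exact (iff_l (P4 v) (or_r (eq_refl v _))).
    + exact (iff_l (P4 v) (or_r (eq_refl v _))).
  - assert (F := iff_l (P2 y) (or_r (eq_refl y _)) : _ ⊩ Var y ≐ Var u ∨ Var y ≐ Var v).
    or_elim F; [|exact F].
    apply (imp_e (imp_e B F)).
    exact (iff_r (P2 v) (or_r (eq_refl v _))).
Qed.

Lemma opair_inj a b c d G :
  (G ⊩ is_set a) -> (G ⊩ is_set b) -> (G ⊩ is_set c) -> (G ⊩ is_set d) ->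
  (G ⊩ opair a b ≐ opair c d) -> (G ⊩ a ≐ c ∧ b ≐ d).
Proof.
  intros Ha Hb Hc Hd H.
  ex_elim Ha x Hx. ex_elim Hb y Hy. ex_elim Hc u Hu. ex_elim Hd v Hv.
  rewrite eqt_same in Hx, Hy, Hu, Hv.
  apply (iff_r (eqt_cong (opair_cong Hx Hy)
    (opair_cong Hu Hv))) in H.
  apply opair_inj_var in H. destruct H as [E F]. split.
  - exact (iff_l (eqt_cong Hx Hu) E).
  - exact (iff_l (eqt_cong Hy Hv) F).
Qed.

Lemma triple_inj x n y x' n' y' G :
  (G ⊩ triple (Var x) (Var n) (Var y) ≐ triple (Var x') (Var n') (Var y')) ->
  (G ⊩ Var x ≐ Var x') /\ (G ⊩ Var y ≐ Var y').
Proof.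
  intro H. apply opair_inj in H; auto using is_set_opair, is_set_sing, is_set_var.
  destruct H as [H K]. split.
  - now apply opair_inj_var in H.
  - apply sing_inj in K; [|apply is_set_sing, is_set_var].
    now apply sing_inj in K; [|apply is_set_var].
Qed.

(** * Orbits *)

(** An orbit is an intersection of sets, so induction along it is restricted to predicates that
    define a set. *)
Lemma orb_ind P R x y G :
  (G ⊩ ex (fun X => all (fun z => iff (atom (Mem z X)) (P z)))) ->
  (G ⊩ orb R x y) -> (G ⊩ P x) ->
  (G ⊩ all (fun u => all (fun v => P u ⇒ rel R u v ⇒ P v))) -> (G ⊩ P y).
Proof.
  intros S H K L. ex_elim S X HX.
  apply (iff_l (HX y)), (imp_e (H X)). split.
  - exact (iff_r (HX x) K).
  - intros u v. assume M. assume N.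
    apply (iff_r (HX v)), (imp_e (imp_e (L u v) (iff_l (HX u) M)) N).
Qed.

Ltac orb_induction P H :=
  lazymatch type of H with force (orb ?R ?x ?y) ?G =>
    let l := variables (@nil nat) in
    apply (orb_ind P R x y);
    [ eapply (comprehension l); [intro; reify | stratify l] | exact H | |  ]
  end.

Lemma orb_refl R x G : G ⊩ orb R x x.
Proof. intro X. assume H. apply H. Qed.

Lemma orb_step {R x y z G} : (G ⊩ orb R x y) -> (G ⊩ rel R y z) -> G ⊩ orb R x z.
Proof.
  intros H K X. assume L. destruct L as [L1 L2].
  apply (imp_e (imp_e (L2 y z) (imp_e (H X) (Logic.conj L1 L2))) K).
Qed.

Lemma orb_trans {R x y z G} : (G ⊩ orb R x y) -> (G ⊩ orb R y z) -> G ⊩ orb R x z.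
Proof.
  intros H K X. assume L.
  apply (imp_e (K X)). split; [|apply L]. exact (imp_e (H X) L).
Qed.

Lemma orb_first R x y G : (G ⊩ orb R x y) ->
  G ⊩ Var y ≐ Var x ∨ ex (fun z => conj (rel R x z) (orb R z y)).
Proof.
  intro H.
  orb_induction (fun y => Var y ≐ Var x ∨ ex (fun z => conj (rel R x z) (orb R z y))) H.
  - apply or_l, eq_refl.
  - intros u v. assume K. assume L. apply or_r. or_elim K.
    + unfold rel in L. subst_in K L. apply ex_i with v. split; [exact L | apply orb_refl].
    + ex_elim K z M. destruct M as [M N]. apply ex_i with z. split; [exact M|].
      eapply orb_step; eauto.
Qed.

Lemma orb_last R x y G : (G ⊩ orb R x y) ->
  G ⊩ Var y ≐ Var x ∨ ex (fun z => conj (orb R x z) (rel R z y)).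
Proof.
  intro H.
  orb_induction (fun y => Var y ≐ Var x ∨ ex (fun z => conj (orb R x z) (rel R z y))) H.
  - apply or_l, eq_refl.
  - intros u v. assume K. assume L. apply or_r, ex_i with u. split; [|exact L].
    or_elim K.
    + apply eq_sym in K. eapply (subst (x :: R :: nil) _ (fun u => orb R x u));
       [intro; reify | exact K | apply orb_refl].
    + ex_elim K z M. destruct M as [M N]. eapply orb_step; eauto.
Qed.

Ltac name_set a p K :=
  lazymatch goal with |- force _ ?G =>
    let H := fresh "H" in
    assert (H : G ⊩ is_set a)
      by auto 9 using is_set_var, is_set_sing, is_set_upair, is_set_opair, is_set_triple;
    unfold is_set in H; ex_elim H p K
  end.

(** * Orbits of functional relations *)

Definition functional (R : nat) : prop :=
  all (fun x => all (fun y => all (fun z => rel R x y ⇒ rel R x z ⇒ Var y ≐ Var z))).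

Lemma functional_e {R x y z G} :
  (G ⊩ functional R) -> (G ⊩ rel R x y) -> (G ⊩ rel R x z) -> G ⊩ Var y ≐ Var z.
Proof. intros F H K. exact (imp_e (imp_e (F x y z) H) K). Qed.

Lemma contradiction {P Q G} : (G ⊩ ¬ P) -> (G ⊩ P) -> G ⊩ Q.
Proof. intros H K. apply bot_e. exact (imp_e H K). Qed.

Lemma orb_next {R x x' y G} : (G ⊩ functional R) -> (G ⊩ orb R x y) -> (G ⊩ rel R x x') ->
  G ⊩ Var y ≐ Var x ∨ orb R x' y.
Proof.
  intros F H K. apply orb_first in H. or_elim H; [now apply or_l|]. apply or_r.
  ex_elim H z L. destruct L as [L M].
  assert (E := functional_e F L K). subst_in E M. exact M.
Qed.

(** Induction along the path to [b]. If [a] reaches [u], it reaches the successor [v] of [u]. If [u]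
    reaches [a], the path either is trivial, and then [a] steps to [v], or passes through [v]. No
    equality has to be decided. *)
Lemma orb_comparable {R c a b G} : (G ⊩ functional R) -> (G ⊩ orb R c a) -> (G ⊩ orb R c b) ->
  G ⊩ orb R a b ∨ orb R b a.
Proof.
  intros F H K. orb_induction (fun b => orb R a b ∨ orb R b a) K.
  - now apply or_r.
  - intros u v. assume L. assume M. or_elim L.
    + apply or_l. eapply orb_step; eauto.
    + assert (D := orb_next F L M). or_elim D; [|now apply or_r].
      apply eq_sym in D. subst_in D M. apply or_l.
      eapply orb_step; [apply orb_refl | exact M].
Qed.

(** Induction along the path to [z]. A path from [u] to [b] passes through the successor of [u]
    unless [u] is [b]; in that case the successor is [c], from which [b] is reachable. *)
Lemma loop_back {R b c z G} : (G ⊩ functional R) -> (G ⊩ rel R b c) -> (G ⊩ orb R c b) ->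
  (G ⊩ orb R c z) -> G ⊩ orb R z b.
Proof.
  intros F H K L. orb_induction (fun z => orb R z b) L.
  - exact K.
  - intros u v. assume M. assume N.
    assert (D := orb_next F M N). or_elim D; [|exact D].
    subst_in D H. assert (E := functional_e F H N). subst_in E K. exact K.
Qed.

(** A pair determines its components only up to equality of the object theory, so [P] has to respect
    that equality. *)
Lemma graph_exists P G :
  (G ⊩ ex (fun R => all (fun p => iff (atom (Mem p R))
     (ex (fun u => ex (fun v => Var p ≐ opair (Var u) (Var v) ∧ P u v)))))) ->
  (G ⊩ all (fun u => all (fun v => all (fun u' => all (fun v' =>
     Var u ≐ Var u' ⇒ Var v ≐ Var v' ⇒ P u v ⇒ P u' v'))))) ->
  G ⊩ ex (fun R => all (fun u => all (fun v => iff (rel R u v) (P u v)))).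
Proof.
  intros H S. ex_elim H R HR. apply ex_i with R. intros u v. split.
  - assume K. ex_elim K p Hp. destruct Hp as [Hp K].
    apply (iff_l (HR p)) in K. ex_elim K u' K. ex_elim K v' K. destruct K as [E K].
    assert (E' := eqt_trans (eqt_sym E) Hp).
    apply opair_inj_var in E'. destruct E' as [E1 E2].
    exact (imp_e (imp_e (imp_e (S u' v' u v) E1) E2) K).
  - assume K. name_set (opair (Var u) (Var v)) p Hp. apply ex_i with p. split; [exact Hp|].
    apply (iff_r (HR p)). apply ex_i with u, ex_i with v. split; [exact Hp|exact K].
Qed.

(* Cut the successor relation at [x] and [y]: the orbit of [c] still contains both, and both are
   now end points of it, so comparability identifies them. *)
Lemma loop_inj R c x y G : (G ⊩ functional R) ->
  (G ⊩ all (fun u => orb R c u ⇒ decided u x ∧ decided u y)) ->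
  (G ⊩ rel R x c) -> (G ⊩ rel R y c) -> (G ⊩ orb R c x) -> (G ⊩ orb R c y) ->
  G ⊩ Var x ≐ Var y.
Proof.
  intros F D X Y CX CY.
  assert (H : G ⊩ ex (fun R' => all (fun u => all (fun v =>
    iff (rel R' u v) (rel R u v ∧ ¬ Var u ≐ Var x ∧ ¬ Var u ≐ Var y))))).
  { apply graph_exists.
    - comprehend (fun p => (ex (fun u => ex (fun v => Var p ≐ opair (Var u) (Var v) ∧
        (rel R u v ∧ ¬ Var u ≐ Var x ∧ ¬ Var u ≐ Var y))))) R' HR'.
      now apply ex_i with R'.
    - intros u v u' v'. assume E. assume E'. assume K. subst_in E K. subst_in E' K. exact K. }
  ex_elim H R' HR.
  (* A path in [R] that leaves [x] or [y] arrives at [c], where a path in [R'] can start afresh. The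
     second conjunct keeps [u] on the orbit, where its equality with [x] and [y] is decided. *)
  assert (K : G ⊩ all (fun z => orb R c z ⇒ orb R' c z ∧ orb R c z)).
  { intro z. assume H. orb_induction (fun z => orb R' c z ∧ orb R c z) H.
    - split; apply orb_refl.
    - intros u v. assume K. assume L. destruct K as [K K']. split; [|eapply orb_step; eauto].
      assert (Du := imp_e (D u) K'). destruct Du as [Dx Dy].
      or_elim Dx.
      { subst_in Dx L. assert (E := functional_e F X L).
        assert (B := orb_refl R' c G).
        eapply (subst (c :: R' :: nil) _ (fun v => orb R' c v));
          [intro; reify | exact E | exact B]. }
      or_elim Dy.
      { subst_in Dy L. assert (E := functional_e F Y L).
        eapply (subst (c :: R' :: nil) _ (fun v => orb R' c v));
          [intro; reify | exact E | apply orb_refl]. }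
      eapply orb_step; [exact K|]. apply (iff_r (HR u v)). now split; [|split]. }
  assert (F' : G ⊩ functional R').
  { intros u v w. assume A. assume B.
    apply (iff_l (HR _ _)) in A. apply (iff_l (HR _ _)) in B.
    destruct A as [A _], B as [B _]. exact (functional_e F A B). }
  apply (imp_e (K x)) in CX. apply (imp_e (K y)) in CY.
  destruct CX as [CX _], CY as [CY _].
  (* Neither [x] nor [y] has a successor under [R'], so whichever of them reaches the other does so
     by the trivial path. *)
  assert (C := orb_comparable F' CX CY).
  or_elim C; apply orb_first in C; or_elim C.
  - now apply eq_sym.
  - ex_elim C z L. destruct L as [L _]. apply (iff_l (HR _ _)) in L.
    destruct L as [_ [L _]]. eapply contradiction; [exact L | apply eq_refl].
  - exact C.
  - ex_elim C z L. destruct L as [L _]. apply (iff_l (HR _ _)) in L.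
    destruct L as [_ [_ L]]. eapply contradiction; [exact L | apply eq_refl].
Qed.

(** * Branchings on an orbit *)

Definition decidable_orbit (R o : nat) : prop :=
  all (fun u => orb R o u ⇒ all (fun v => orb R o v ⇒ decided u v)).

(** Here [c] is the common successor of [k] and [n], and [d] that of [a] and [b]. If [c] reached
    [k], then [k] would lie on a cycle. *)
Lemma unique_branching R o k n c a b d G :
  (G ⊩ functional R) -> (G ⊩ decidable_orbit R o) ->
  (G ⊩ orb R o k) -> (G ⊩ orb R o n) -> (G ⊩ ¬ Var k ≐ Var n) ->
  (G ⊩ rel R k c) -> (G ⊩ rel R n c) -> (G ⊩ ¬ orb R c k) ->
  (G ⊩ orb R o a) -> (G ⊩ orb R o b) -> (G ⊩ ¬ Var a ≐ Var b) ->
  (G ⊩ rel R a d) -> (G ⊩ rel R b d) -> (G ⊩ orb R a b) ->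
  G ⊩ Var a ≐ Var k ∧ Var b ≐ Var n.
Proof.
  intros F D Ok On Nkn Kc Nc Nck Oa Ob Nab Ad Bd AB.
  assert (inj : G ⊩ all (fun e => all (fun x => all (fun y =>
    orb R o e ⇒ rel R x e ⇒ rel R y e ⇒ orb R e x ⇒ orb R e y ⇒ Var x ≐ Var y)))).
  { intros e x y. assume Oe. assume X. assume Y. assume EX. assume EY.
    apply (loop_inj R e x y); auto. intro u. assume L.
    assert (Ou := orb_trans Oe L).
    split; apply (imp_e (imp_e (D u) Ou _));
      apply (orb_trans Oe); assumption. }
  assert (Oc := orb_step Ok Kc). assert (Od := orb_step Oa Ad).
  assert (Cn : G ⊩ orb R c n).
  { assert (C := orb_comparable F Ok On). or_elim C.
    - assert (E := orb_next F C Kc). or_elim E; [|exact E].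
      eapply contradiction; [exact Nkn | now apply eq_sym].
    - assert (E := orb_next F C Nc).
      or_elim E; [exact (contradiction Nkn E) | exact (contradiction Nck E)]. }
  assert (DB : G ⊩ orb R d b).
  { assert (E := orb_next F AB Ad). or_elim E; [|exact E].
    eapply contradiction; [exact Nab | now apply eq_sym]. }
  (* If [n] comes before [b], the path passes through [c] or is trivial. If [b] comes before [n],
     then [n] is [b] or lies on the cycle of [d], and [loop_back] leads from [n] to [b] again. *)
  assert (CB : G ⊩ orb R c b).
  { assert (A : G ⊩ orb R n b ⇒ orb R c b).
    { assume H. assert (E := orb_next F H Nc). or_elim E; [|exact E].
      apply eq_sym in E. subst_in E Cn. exact Cn. }
    assert (C := orb_comparable F On Ob). or_elim C.
    - exact (imp_e A C).
    - assert (E := orb_next F C Bd). or_elim E.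
      + subst_in E Cn. exact Cn.
      + apply (imp_e A). exact (loop_back F Bd DB E). }
  assert (CD := orb_step CB Bd).
  (* If [a] came strictly before [k], then [c] would reach [k] by way of [d]. If [k] came strictly
     before [a], then [a] would be on the cycle together with [b], and injectivity there would
     identify them. *)
  assert (AK : G ⊩ Var a ≐ Var k).
  { assert (C := orb_comparable F Oa Ok). or_elim C.
    - assert (E := orb_next F C Ad). or_elim E; [now apply eq_sym|].
      eapply contradiction; [exact Nck | eapply orb_trans; eauto].
    - assert (E := orb_next F C Kc). or_elim E; [exact E|].
      eapply contradiction; [exact Nab|].
      assert (DN := loop_back F Nc Cn CD).
      assert (DC := orb_step DN Nc).
      assert (DA := orb_trans DC E).
      exact (imp_e (imp_e (imp_e (imp_e (imp_e
        (inj d a b) Od) Ad) Bd) DA) DB). }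
  split; [exact AK|]. subst_in AK Ad.
  (* With [a] equal to [k], also [d] equals [c]; now [b] and [n] are predecessors of [c] on one
     cycle. *)
  assert (E := functional_e F Ad Kc). subst_in E Bd.
  exact (imp_e (imp_e (imp_e (imp_e (imp_e
    (inj c b n) Oc) Bd) Nc) CB) Cn).
Qed.

(** * Church numbers *)

Lemma is_set_empty G : G ⊩ is_set empty.
Proof. comprehend (fun z : nat => atom Bot) e He. now apply ex_i with e. Qed.

Lemma is_set_union x c G : G ⊩ is_set (union (Var x) (sing (Var c))).
Proof.
  comprehend (fun z => has (union (Var x) (sing (Var c))) z) y Hy. now apply ex_i with y.
Qed.

Lemma is_set_ident G : G ⊩ is_set ident.
Proof. comprehend (fun z => has ident z) e He. now apply ex_i with e. Qed.

Lemma is_set_zero G : G ⊩ is_set zero.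
Proof. comprehend (fun z => has zero z) e He. now apply ex_i with e. Qed.

Lemma is_set_succ_of z G : G ⊩ is_set (succ_of (Var z)).
Proof. comprehend (fun v => has (succ_of (Var z)) v) e He. now apply ex_i with e. Qed.

Lemma is_set_SUCC G : G ⊩ is_set SUCC.
Proof. comprehend (fun v => has SUCC v) e He. now apply ex_i with e. Qed.

Lemma mem_i a p X G : (G ⊩ Var p ≐ a) -> (G ⊩ Var p ∈ Var X) -> G ⊩ a ∈ Var X.
Proof. intros E H. apply (iff_r (mem_set a X G)), ex_i with p. now split. Qed.

Lemma Ap_cong f g x G : (G ⊩ all (fun z => iff (has f z) (has g z))) ->
  G ⊩ same (Ap f (Var x)) (Ap g (Var x)).
Proof.
  intros H t. apply iff_ex. intro y. apply iff_conj; [|apply iff_refl].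
  apply iff_ex. intro p. apply iff_conj; [apply iff_refl | apply H].
Qed.

(** With a set in place of [SUCC], only the short formula for application has to be comprehended. *)
Lemma is_set_succ n G : G ⊩ is_set (succ (Var n)).
Proof.
  assert (H := is_set_SUCC G). ex_elim H s Hs. apply eqt_same in Hs.
  apply (is_set_same (Ap (Var s) (Var n))); [now apply Ap_cong|]. clear Hs.
  comprehend (fun t => has (Ap (Var s) (Var n)) t) a Ha. now apply ex_i with a.
Qed.

(** Not restricted to [NN]: application is a union and so gives a set for every argument, which
    makes the graph total without side conditions. *)
Definition succ_graph (R : nat) : prop :=
  all (fun x => all (fun y => iff (rel R x y) (Var y ≐ succ (Var x)))).

Lemma succ_graph_exists G : G ⊩ ex succ_graph.
Proof.
  assert (H := is_set_SUCC G). ex_elim H s Hs. apply eqt_same in Hs.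
  assert (H : G ⊩ ex (fun R => all (fun x => all (fun y =>
    iff (rel R x y) (Var y ≐ Ap (Var s) (Var x)))))).
  { clear Hs. apply graph_exists.
    - comprehend (fun p => (ex (fun u => ex (fun v => Var p ≐ opair (Var u) (Var v) ∧
        Var v ≐ Ap (Var s) (Var u))))) R' HR'.
      now apply ex_i with R'.
    - intros u v u' v'. assume E. assume E'. assume K. subst_in E K. subst_in E' K. exact K. }
  ex_elim H R HR. apply ex_i with R. intros x y. eapply iff_trans; [apply HR|].
  apply eqt_cong; [apply same_refl | now apply Ap_cong].
Qed.

Lemma succ_functional R G : (G ⊩ succ_graph R) -> G ⊩ functional R.
Proof.
  intros H x y z. assume K. assume L.
  apply (iff_l (H _ _)) in K. apply (iff_l (H _ _)) in L.
  exact (eqt_trans K (eqt_sym L)).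
Qed.

(** The universe [V] contains both the pair of [V] with itself and the pair of [V] with the empty
    set; as a function it would make [V] empty. *)
Lemma universal_not_function G :
  G ⊩ ex (fun V => all (fun z => has (Var V) z) ∧ ¬ Var V ∈ FUNC).
Proof.
  comprehend (fun z => Var z ≐ Var z) V HV.
  assert (all_in : G ⊩ all (fun z => has (Var V) z)).
  { intro z. apply (iff_r (HV z)), eq_refl. }
  clear HV. apply ex_i with V. split; [exact all_in|]. assume F.
  assert (H := is_set_empty G). ex_elim H e He.
  name_set (opair (Var V) (Var V)) p Hp. name_set (opair (Var V) (Var e)) q Hq.
  assert (E := imp_e (imp_e (F V V e) (mem_i _ _ _ _ Hp (all_in p)))
    (mem_i _ _ _ _ Hq (all_in q))).
  apply eqt_same in E. exact (iff_l (He V) (iff_l (E V) (all_in V))).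
Qed.

(* Every element of [succ x] is a pair whose first component is a function, but [zero] contains
   pairs with arbitrary first components. *)
Lemma zero_not_succ x Q G : (G ⊩ zero ≐ succ (Var x)) -> G ⊩ Q.
Proof.
  intro H. assert (V := universal_not_function G). ex_elim V V K. destruct K as [_ NF].
  assert (I := is_set_ident G). ex_elim I i Hi.
  name_set (opair (Var V) (Var i)) p Hp.
  assert (Z : G ⊩ has zero p).
  { apply ex_i with V. split; [apply eq_refl|].
    apply eqt_same. apply eqt_same in Hp. eapply same_trans; [exact Hp|].
    apply opair_cong; [apply same_refl | now apply eqt_same]. }
  apply (iff_l (H p)) in Z. ex_elim Z y Y. destruct Y as [Y P].
  ex_elim Y v Y. destruct Y as [E Y]. ex_elim Y z Y. destruct Y as [E' F].
  assert (E2 := eqt_trans (eqt_sym E) E').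
  apply opair_inj in E2; auto using is_set_var, is_set_succ_of.
  destruct E2 as [_ E2]. apply eqt_same in E2. apply (iff_l (E2 p)) in P.
  ex_elim P f P. ex_elim P q P. destruct P as [E3 [F' _]].
  assert (E4 := eqt_trans (eqt_sym E3) Hp).
  apply opair_inj_var in E4. destruct E4 as [E4 _].
  apply (contradiction NF). subst_in E4 F'. exact F'.
Qed.

Lemma succ_mem R u v X G : (G ⊩ succ_graph R) -> (G ⊩ rel R u v) ->
  G ⊩ iff (succ (Var u) ∈ Var X) (Var v ∈ Var X).
Proof.
  intros S H. apply (iff_l (S _ _)) in H. apply mem_cong, same_sym, eqt_same, H.
Qed.

Lemma succ_total R u G : (G ⊩ succ_graph R) -> G ⊩ ex (fun v => rel R u v).
Proof.
  intro S. assert (H := is_set_succ u G). ex_elim H v Hv. apply ex_i with v.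
  exact (iff_r (S u v) Hv).
Qed.

Lemma closed_under_succ R X G : (G ⊩ succ_graph R) ->
  G ⊩ iff (∀ u, u ∈ Var X ⇒ succ u ∈ Var X)
          (∀ u v, u ∈ Var X ⇒ opair u v ∈ Var R ⇒ v ∈ Var X).
Proof.
  intro S. apply iff_i. intros G' I. weaken G G' I. split; intro H.
  - intros u v. assume K. assume L.
    exact (iff_l (succ_mem _ _ _ X _ S L) (imp_e (H u) K)).
  - intro u. assume K. assert (L := succ_total R u G S). ex_elim L v L.
    exact (iff_r (succ_mem _ _ _ X _ S L) (imp_e (imp_e (H u v) K) L)).
Qed.

(** Both sides have the same shape, so replacing [zero] by [o] and [succ] by steps of [R] is a
    matter of congruence. *)
Lemma NN_orbit R o x G : (G ⊩ succ_graph R) -> (G ⊩ Var o ≐ zero) ->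
  G ⊩ iff (Var x ∈ NN) (orb R o x).
Proof.
  intros S Z. apply iff_all. intro X. apply iff_imp; [|apply iff_refl].
  apply iff_conj; [|now apply closed_under_succ].
  apply mem_cong, same_sym, eqt_same, Z.
Qed.

(** * Decidable equality on finite sets *)

Lemma decided_sym x y G : (G ⊩ decided x y) -> G ⊩ decided y x.
Proof.
  intro H. or_elim H; [apply or_l; now apply eq_sym|]. apply or_r. assume E.
  apply (imp_e H). now apply eq_sym.
Qed.

Lemma decided_notin x u v G : (G ⊩ Var u ∈ Var x) -> (G ⊩ ¬ Var v ∈ Var x) -> G ⊩ decided u v.
Proof.
  intros H K. apply or_r. assume E. apply (imp_e K). subst_in E H. exact H.
Qed.

(** Induction on finite sets: an element [c] added from outside [x] differs from every element of
    [x], so the new comparisons are decided. *)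
Lemma FINITE_decidable a G : (G ⊩ Var a ∈ FINITE) ->
  G ⊩ all (fun u => all (fun v => Var u ∈ Var a ⇒ Var v ∈ Var a ⇒ decided u v)).
Proof.
  intro H. comprehend (fun a =>
    all (fun u => all (fun v => Var u ∈ Var a ⇒ Var v ∈ Var a ⇒ decided u v))) w Hw.
  apply (iff_l (Hw a)). apply (imp_e (H w)). clear H. split.
  - assert (E := is_set_empty G). ex_elim E e He. apply ex_i with e. split; [exact He|].
    apply (iff_r (Hw e)). intros u v. assume K. assume L.
    apply bot_e. exact (iff_l (He u) K).
  - intros x c. assume H. destruct H as [H N]. apply (iff_l (Hw x)) in H.
    assert (E := is_set_union x c G). ex_elim E y Hy. apply ex_i with y. split; [exact Hy|].
    apply (iff_r (Hw y)). intros u v. assume K. assume L.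
    apply (iff_l (Hy u)) in K. apply (iff_l (Hy v)) in L.
    or_elim K; or_elim L.
    + exact (imp_e (imp_e (H u v) K) L).
    + apply (decided_notin x); [exact K|]. assume M. apply (imp_e N).
      assert (E : G ⊩ Var v ≐ Var c) by exact L. subst_in E M. exact M.
    + apply decided_sym, (decided_notin x); [exact L|]. assume M. apply (imp_e N).
      assert (E : G ⊩ Var u ≐ Var c) by exact K. subst_in E M. exact M.
    + apply or_l. exact (eq_trans K (eq_sym L)).
Qed.

Lemma zero_no_pred R o u Q G : (G ⊩ succ_graph R) -> (G ⊩ Var o ≐ zero) ->
  (G ⊩ rel R u o) -> G ⊩ Q.
Proof.
  intros S Z H. apply (iff_l (S _ _)) in H. apply (zero_not_succ u).
  exact (eqt_trans (eqt_sym Z) H).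
Qed.

(** Induction on the stem. A cycle through zero would give zero a predecessor. A cycle through [S u]
    enters it from some number, which has to be [u] because [S u] is no double successor; so [u]
    would be on that cycle as well. *)
Lemma STEM_acyclic R o k G : (G ⊩ succ_graph R) -> (G ⊩ Var o ≐ zero) ->
  (G ⊩ Var k ∈ STEM) -> G ⊩ all (fun c => rel R k c ⇒ ¬ orb R c k).
Proof.
  intros S Z [_ H]. comprehend (fun u => all (fun c => rel R u c ⇒ ¬ orb R c u)) X HX.
  apply (iff_l (HX k)). apply (imp_e (H X)). clear H. split.
  - apply ex_i with o. split; [exact Z|]. apply (iff_r (HX o)).
    intro c. assume K. assume L. apply orb_last in L. or_elim L.
    + apply (zero_no_pred R o o); auto. apply eq_sym in L. subst_in L K. exact K.
    + ex_elim L z L. destruct L as [_ L]. now apply (zero_no_pred R o z).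
  - intro u. assume U. assume H. destruct H as [H uniq]. apply (iff_l (HX u)) in H.
    assert (U1 := succ_total R u G S). ex_elim U1 u1 U1.
    apply (iff_r (succ_mem _ _ _ X _ S U1)), (iff_r (HX u1)).
    intro u2. assume U2. assume L.
    apply (iff_l (NN_orbit R o u G S Z)) in U.
    (* The point from which the cycle enters [u1]. A trivial path from [u2] to [u1] means a loop at
       [u1], which is then its own predecessor. *)
    assert (P : G ⊩ ex (fun z => orb R u2 z ∧ rel R z u1)).
    { assert (M := orb_last _ _ _ _ L). or_elim M; [|exact M].
      apply ex_i with u1. split; [exact L|]. apply eq_sym in M. subst_in M U2. exact U2. }
    ex_elim P z P. destruct P as [P1 P2].
    assert (O1 := orb_step (orb_refl R u1 G) U2).
    assert (O2 := orb_trans O1 P1).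
    assert (O3 := orb_trans (orb_step U U1) O2).
    apply (iff_r (NN_orbit R o z G S Z)) in O3.
    assert (P2' := iff_l (S _ _) P2). assert (U1' := iff_l (S _ _) U1).
    assert (E := imp_e (imp_e (uniq z) O3)
      (eqt_trans (eqt_sym P2') U1') : G ⊩ Var z ≐ Var u).
    apply (imp_e (imp_e (H u1) U1)). clear P2 P2' U1'. subst_in E O2. exact O2.
Qed.

(** The triples whose third component is reachable from the first form a set with the closure
    properties that define [Sum], hence include all of [Sum]. *)
Lemma lt_orbit R j l G : (G ⊩ succ_graph R) -> (G ⊩ lt (Var j) (Var l)) -> G ⊩ orb R j l.
Proof.
  intros S H. ex_elim H m H. destruct H as [_ [[_ H] _]].
  ex_elim H v H. destruct H as [E H].
  assert (M := is_set_succ m G). ex_elim M w Hw. apply eqt_same in Hw.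
  assert (Z := is_set_zero G). ex_elim Z o Z.
  comprehend (fun v => ex (fun x => ex (fun n => ex (fun y =>
    Var v ≐ triple (Var x) (Var n) (Var y) ∧ orb R x y)))) X HX.
  assert (intro_X : G ⊩ all (fun x => all (fun n => all (fun y =>
    orb R x y ⇒ triple (Var x) (Var n) (Var y) ∈ Var X)))).
  { clear E H Hw Z. intros x n y. assume B. name_set (triple (Var x) (Var n) (Var y)) t Ht.
    apply ex_i with t. split; [exact Ht|]. apply (iff_r (HX t)).
    apply ex_i with x, ex_i with n, ex_i with y. now split. }
  assert (elim_X : G ⊩ all (fun x => all (fun n => all (fun y =>
    triple (Var x) (Var n) (Var y) ∈ Var X ⇒ orb R x y)))).
  { clear E H Hw Z intro_X. intros x n y. assume T. ex_elim T t T. destruct T as [E T].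
    apply (iff_l (HX t)) in T.
    ex_elim T x' T. ex_elim T n' T. ex_elim T y' T. destruct T as [E' B].
    assert (D := eqt_trans (eqt_sym E') E). apply triple_inj in D.
    destruct D as [Dx Dy]. subst_in Dx B. subst_in Dy B. exact B. }
  clear HX.
  apply (imp_e (elim_X j w l)). apply ex_i with v. split.
  { apply eqt_same. apply eqt_same in E. eapply same_trans; [exact E|].
    apply triple_cong; auto using same_refl, same_sym. }
  apply (imp_e (H X)). clear E H Hw. split.
  - intro x. assume N. apply eqt_same in Z.
    apply (iff_l (mem_cong _ _ X _ (triple_cong
      (same_refl (Var x) _) Z (same_refl (Var x) _)))).
    apply (imp_e (intro_X x o x)), orb_refl.
  - intros x n y. assume N. clear N. assume T. apply (imp_e (elim_X x n y)) in T.
    assert (U := succ_total R y G S). ex_elim U y1 U.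
    assert (W := is_set_succ n G). ex_elim W n1 W. apply eqt_same in W.
    assert (U' := iff_l (S _ _) U). apply eqt_same in U'.
    apply (iff_l (mem_cong _ _ X _ (triple_cong
      (same_refl (Var x) _) W U'))).
    apply (imp_e (intro_X x n1 y1)). eapply orb_step; eauto.
Qed.

Lemma statement_holds G : G ⊩ Sem.statement.
Proof.
  assume Fin. ex_elim Fin N Fin. destruct Fin as [EN Fin]. apply FINITE_decidable in Fin.
  apply eqt_same in EN.
  assert (Z := is_set_zero G). ex_elim Z o Z.
  assert (S := succ_graph_exists G). ex_elim S R S.
  assert (F := succ_functional R G S).
  assert (NO : G ⊩ all (fun x => iff (Var x ∈ NN) (orb R o x))).
  { intro x. exact (NN_orbit R o x G S Z). }
  assert (D : G ⊩ decidable_orbit R o).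
  { intro u. assume U. intro v. assume V.
    apply (imp_e (imp_e (Fin u v)
      (iff_r (EN u) (iff_r (NO u) U)))
      (iff_r (EN v) (iff_r (NO v) V))). }
  clear Fin EN.
  intros k n. assume H. destruct H as [K [On [Nkn E]]].
  assert (Ok := iff_l (NO k) (proj1 K)). apply (iff_l (NO n)) in On.
  assert (A := STEM_acyclic R o k G S Z K).
  assert (C := succ_total R k G S). ex_elim C c Kc. assert (Nck := imp_e (A c) Kc).
  assert (Ec := iff_l (S k c) Kc).
  assert (Nc := iff_r (S n c) (eqt_trans Ec E)).
  (* The common core of both conclusions: reachability from [a] to [b] comes from comparability in
     the first and from [lt] in the second. *)
  assert (U : G ⊩ all (fun a => all (fun b => all (fun d => Var a ∈ NN ⇒ Var b ∈ NN ⇒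
    ¬ Var a ≐ Var b ⇒ rel R a d ⇒ rel R b d ⇒ orb R a b ⇒
    Var a ≐ Var k ∧ Var b ≐ Var n)))).
  { clear E Ec. intros a b d. assume Oa. assume Ob. assume Nab. assume Ad. assume Bd. assume AB.
    apply (iff_l (NO a)) in Oa. apply (iff_l (NO b)) in Ob.
    exact (unique_branching R o k n c a b d G F D Ok On Nkn Kc Nc Nck Oa Ob Nab Ad Bd AB). }
  split.
  - apply ex_i with c. split.
    + apply ex_i with k, ex_i with n. split; [exact (proj1 K)|].
      split; [exact (iff_r (NO n) On)|]. split; [exact Nkn|].
      split; [exact Ec | exact (eqt_trans Ec E)].
    + clear E Ec. intro q. assume Q. ex_elim Q a Q. ex_elim Q b Q.
      destruct Q as [Na [Nb [Nab [Aq Bq]]]].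
      apply (iff_r (S a q)) in Aq. apply (iff_r (S b q)) in Bq.
      (* The definition of double successor does not order [a] and [b]. Whichever comes first is
         [k], so either way [q] is the successor of [k]. *)
      assert (L := orb_comparable F (iff_l (NO a) Na) (iff_l (NO b) Nb)).
      or_elim L.
      * assert (X := imp_e (imp_e (imp_e (imp_e (imp_e
          (imp_e (U a b q) Na) Nb) Nab) Aq) Bq) L).
        destruct X as [X _]. subst_in X Aq. exact (functional_e F Aq Kc).
      * assert (Nba : G ⊩ ¬ Var b ≐ Var a).
        { assume X. apply (imp_e Nab). now apply eq_sym. }
        assert (X := imp_e (imp_e (imp_e (imp_e (imp_e
          (imp_e (U b a q) Nb) Na) Nba) Bq) Aq) L).
        destruct X as [X _]. subst_in X Bq. exact (functional_e F Bq Kc).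
  - clear E Ec. intros j l. assume Q. destruct Q as [Nj [Nl [Njl [L E]]]].
    apply (lt_orbit R j l G S) in L.
    assert (C := succ_total R j G S). ex_elim C d Jd.
    assert (Ed := iff_l (S j d) Jd).
    assert (Ld := iff_r (S l d) (eqt_trans Ed E)).
    exact (imp_e (imp_e (imp_e (imp_e (imp_e
      (imp_e (U j l d) Nj) Nl) Njl) Jd) Ld) L).
Qed.

End Internal.

Theorem theorem13p3 :
  nd INF nil (closed (
    NN ∈ FINITE ⇒
    ∀ k n,
      k ∈ STEM ∧ n ∈ NN ∧ ¬ k ≐ n ∧ succ k ≐ succ n ⇒
      fex_unique double_successor ∧
      (∀ j l,
         j ∈ NN ∧ l ∈ NN ∧ ¬ j ≐ l ∧ lt j l ∧ succ j ≐ succ l ⇒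
         j ≐ k ∧ l ≐ n))).
Proof.
  apply denotes_closed with Sem.statement; [|exact Internal.statement_holds].
  unfold Sem.statement. denotation. all: apply denotes_fex_unique; denotation.
Qed.
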